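(* Let $\xi=(\xi(x))_{x\in\mathbb{R}^d}$ be a real-valued, zero-mean, second-order random process with continuous covariance function $k(x,y)=\mathsf{E}[\xi(x)\xi(y)]$. (i) Suppose that $\xi$ is second-order stationary and has a spectral density $S$ for which there exist $C>0$ and an integer $r\ge 1$ such that $S(u)\,(1+|u|^r)\ge C$ for almost every $u\in\mathbb{R}^d$. Then $\xi$ has the No-Empty-Ball (NEB) property. (ii) Suppose that $k(x,y)=s^2 e^{-\alpha\|x-y\|^2}$ for all $x,y\in\mathbb{R}^d$, for some $s>0$ and $\alpha>0$. Then $\xi$ does not possess the NEB property.
   Context: For a sequence $(x_n)_{n\ge1}$ in $\mathbb{R}^d$ write $\underline{x}_n=(x_1,\dots,x_n)$. For $x\in\mathbb{R}^d$, the kriging predictor $\hat\xi(x;\underline{x}_n)$ is the orthogonal projection in $L^2(\Omega,\mathcal{A},\mathsf{P})$ of $\xi(x)$ onto $\mathrm{span}\{\xi(x_1),\dots,\xi(x_n)\}$, and the kriging variance is $\sigma^2(x;\underline{x}_n)=\mathrm{var}[\xi(x)-\hat\xi(x;\underline{x}_n)]$. NEB property: the process $\xi$ has the No-Empty-Ball property if, for all sequences $(x_n)_{n\ge1}$ in $\mathbb{R}^d$ and all $x\in\mathbb{R}^d$, the following are equivalent: (a) $x$ is an adherent point of the set $\{x_n : n\ge1\}$ (i.e. $x$ belongs to its closure); (b) $\sigma^2(x;\underline{x}_n)\to0$ as $n\to\infty$. Spectral density: $\xi$ is second-order stationary if $k(x,y)$ depends only on $x-y$; it has spectral density $S$ if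 $S\ge 0$ is integrable on $\mathbb{R}^d$ and $k(x,y)=(2\pi)^{-d}\int_{\mathbb{R}^d}e^{i u\cdot(x-y)}S(u)\,du$ (the normalization constant is immaterial). $|\cdot|$ and $\|\cdot\|$ denote the Euclidean norm on $\mathbb{R}^d$. *)

(* Defs.v *)
From HB Require Import structures.
From mathcomp Require Import all_boot all_order all_algebra.
From mathcomp Require Import complex.
From mathcomp Require Import all_classical all_reals all_analysis.

Set Implicit Arguments.
Unset Strict Implicit.
Unset Printing Implicit Defensive.

Import Order.TTheory GRing.Theory Num.Theory.
Import numFieldNormedType.Exports.

Local Open Scope classical_set_scope.
Local Open Scope ring_scope.

(* R^d is 'rV[R]_d.  The library's norm on it is the sup norm: it induces the
   usual topology, but Euclidean norms have to be written explicitly. *)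
Section euclidean.
Context {R : realType} {d : nat}.
Implicit Types u v : 'rV[R]_d.

Definition dotr u v : R := \sum_(i < d) u ord0 i * v ord0 i.

Definition enorm u : R := Num.sqrt (dotr u u).

End euclidean.

(* The product sigma-algebra on row vectors, generated by the coordinates (as
   the library does for tuples); on 'rV[R]_n it is the Borel sigma-algebra. *)
Definition rV_display : measure_display -> measure_display.
Proof. exact. Qed.

Definition rV_coord {T : Type} {n : nat} (i : 'I_n) (u : 'rV[T]_n) : T :=
  u ord0 i.

Section measurable_rV.
Context {disp : measure_display} {T : measurableType disp} {n : nat}.

Let rV_set0 : g_sigma_preimage (@rV_coord T n) set0.
Proof. exact: sigma_algebra0. Qed.

Let rV_setC A :
  g_sigma_preimage (@rV_coord T n) A -> g_sigma_preimage (@rV_coord T n) (~` A).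
Proof. exact: sigma_algebraC. Qed.

Let rV_bigcup (F : _^nat) : (forall i, g_sigma_preimage (@rV_coord T n) (F i)) ->
  g_sigma_preimage (@rV_coord T n) (\bigcup_i F i).
Proof. exact: sigma_algebra_bigcup. Qed.

HB.instance Definition _ := @isMeasurable.Build (rV_display disp)
  'rV[T]_n (g_sigma_preimage (@rV_coord T n)) rV_set0 rV_setC rV_bigcup.

Lemma measurable_rV_coord (i : 'I_n) :
  measurable_fun [set: 'rV[T]_n] (rV_coord i).
Proof.
move=> _ Y mY; rewrite setTI; apply: sub_sigma_algebra => /=.
rewrite -bigcup_seq/=; exists i => /=; first by rewrite mem_index_enum.
by exists Y => //; rewrite setTI.
Qed.

Lemma measurable_rV_box (A : 'I_n -> set T) : (forall i, measurable (A i)) ->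
  measurable [set u : 'rV[T]_n | forall i, A i (u ord0 i)].
Proof.
move=> mA; rewrite (_ : mkset _ = \bigcap_(i in setT) (rV_coord i @^-1` A i)).
  apply: fin_bigcap_measurable => [|i _]; first exact: finite_finset.
  by rewrite -[X in measurable X]setTI; exact: measurable_rV_coord.
by apply/seteqP; split => u /= Au; [move=> i _|move=> i]; exact: Au.
Qed.

End measurable_rV.

Lemma measurable_fun_rVP disp1 disp2 (T1 : measurableType disp1)
    (T2 : measurableType disp2) n (f : T1 -> 'rV[T2]_n) :
  (forall i, measurable_fun [set: T1] (rV_coord i \o f)) ->
  measurable_fun [set: T1] f.
Proof.
move=> mf _ A; rewrite setTI.
set U : set (set 'rV[T2]_n) := [set B | measurable (f @^-1` B)].
suff: g_sigma_preimage (@rV_coord T2 n) `<=` U by move=> sU /sU.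
apply: smallest_sub => [|B].
  split; rewrite /U /=.
  - by rewrite preimage_set0; exact: measurable0.
  - by move=> C mC; rewrite setTD preimage_setC; exact: measurableC.
  - by move=> F mF; rewrite preimage_bigcup; exact: bigcup_measurable.
rewrite -bigcup_seq => -[i _ [Y mY <-]]; rewrite /U /= setTI.
by have := mf i measurableT Y mY; rewrite setTI.
Qed.

(* Lebesgue measure on R^n, as the n-fold product of the one on R. *)
Section lebesgue_rV.
Context {R : realType}.

Definition consr n (p : measurableTypeR R * 'rV[R]_n) : 'rV[R]_n.+1 :=
  row_mx (p.1)%:M p.2.

Lemma consr0 n p : @consr n p ord0 ord0 = p.1.
Proof.
transitivity (@row_mx R 1 1 n (p.1)%:M p.2 ord0 (lshift n ord0)).
  by congr (row_mx _ _ _ _); exact: val_inj.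
by rewrite row_mxEl mxE.
Qed.

Lemma consr_lift n p i : @consr n p ord0 (lift ord0 i) = p.2 ord0 i.
Proof.
transitivity (@row_mx R 1 1 n (p.1)%:M p.2 ord0 (rshift 1 i)).
  by congr (row_mx _ _ _ _); exact: val_inj.
by rewrite row_mxEr.
Qed.

Lemma measurable_consr n : measurable_fun [set: _] (@consr n).
Proof.
apply: measurable_fun_rVP => i; case: (unliftP ord0 i) => [j|] ->.
  rewrite (_ : _ \o _ = rV_coord j \o snd); last first.
    by apply/funext => p /=; rewrite /rV_coord consr_lift.
  by apply: measurableT_comp => //; exact: measurable_rV_coord.
rewrite (_ : _ \o _ = fst) //.
by apply/funext => p /=; rewrite /rV_coord consr0.
Qed.

Section step.
Context n (mu : {sigma_finite_measure set 'rV[R]_n -> \bar R}).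

Definition lebesgue_cons : set 'rV[R]_n.+1 -> \bar R :=
  pushforward (lebesgue_measure \x mu)%E (@consr n).

Let measurable_preimage_consr (A : set 'rV[R]_n.+1) :
  measurable A -> measurable (@consr n @^-1` A).
Proof.
by move=> mA; rewrite -[X in measurable X]setTI; exact: measurable_consr.
Qed.

Let lebesgue_cons0 : lebesgue_cons set0 = 0%E.
Proof. by rewrite /lebesgue_cons /pushforward preimage_set0 measure0. Qed.

Let lebesgue_cons_ge0 A : (0 <= lebesgue_cons A)%E.
Proof. by rewrite /lebesgue_cons /pushforward; exact: measure_ge0. Qed.

Let lebesgue_cons_sigma_additive : semi_sigma_additive lebesgue_cons.
Proof.
move=> F mF tF mUF; rewrite /lebesgue_cons /pushforward preimage_bigcup.
apply: measure_semi_sigma_additive.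
- by move=> k; exact: measurable_preimage_consr.
- apply/trivIsetP => /= i j _ _ ij; rewrite -preimage_setI.
  by move/trivIsetP : tF => /(_ _ _ _ _ ij) ->//; rewrite preimage_set0.
- by rewrite -preimage_bigcup; exact: measurable_preimage_consr.
Qed.

HB.instance Definition _ := isMeasure.Build _ _ _ lebesgue_cons
  lebesgue_cons0 lebesgue_cons_ge0 lebesgue_cons_sigma_additive.

Let lebesgue_cons_sigma_finite : sigma_finite setT lebesgue_cons.
Proof.
have [F FT mF] : sigma_finite setT (lebesgue_measure \x mu)%E.
  have /sigma_finiteP[F [TF ndF Foo]] : sigma_finite setT (@lebesgue_measure R).
    exact: sigma_finiteT.
  have /sigma_finiteP[G [TG ndG Goo]] := sigma_finiteT mu.
  exists (fun k => F k `*` G k).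
    rewrite -setXTT TF TG predeqE => -[x y]; split.
      move=> [/= [k _ Fkx] [l _ Gly]]; exists (maxn k l) => //; split.
      - by move: x Fkx; exact/subsetPset/ndF/leq_maxl.
      - by move: y Gly; exact/subsetPset/ndG/leq_maxr.
    by move=> [k _ []/= ? ?]; split; exists k.
  move=> k; have [? ?] := Foo k; have [? ?] := Goo k.
  split; first exact: measurableX.
  by rewrite product_measure1E// lte_mul_pinfty// ge0_fin_numE.
pose g (u : 'rV[R]_n.+1) : measurableTypeR R * 'rV[R]_n :=
  (u ord0 ord0, \row_j u ord0 (lift ord0 j)).
have mg : measurable_fun setT g.
  apply: measurable_fun_pair; first exact: (measurable_rV_coord ord0).
  apply: measurable_fun_rVP => i.
  rewrite (_ : _ \o _ = rV_coord (lift ord0 i)).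
    exact: measurable_rV_coord.
  by apply/funext => u; rewrite /rV_coord /= mxE.
have gK p : g (consr p) = p.
  case: p => x u; rewrite /g consr0; congr pair.
  by apply/rowP => j; rewrite mxE consr_lift.
exists (fun k => g @^-1` F k).
  by rewrite -preimage_bigcup -FT preimage_setT.
move=> k; have [mFk Fk] := mF k; split.
  by rewrite -[X in measurable X]setTI; exact: mg.
rewrite /lebesgue_cons /pushforward (_ : _ @^-1` _ = F k)//.
by apply/seteqP; split => p /=; rewrite gK.
Qed.

HB.instance Definition _ := @Measure_isSigmaFinite.Build _ _ _ lebesgue_cons
  lebesgue_cons_sigma_finite.

End step.

Fixpoint lebesgue_rV n : {sigma_finite_measure set 'rV[R]_n -> \bar R} :=
  match n return {sigma_finite_measure set 'rV[R]_n -> \bar R} with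
  | 0 => [the {sigma_finite_measure set 'rV[R]_0 -> \bar R} of dirac (0 : 'rV[R]_0)]
  | n'.+1 => [the {sigma_finite_measure set 'rV[R]_n'.+1 -> \bar R} of
               lebesgue_cons (lebesgue_rV n')]
  end.

Lemma lebesgue_rV_box n (A : 'I_n -> set (measurableTypeR R)) :
  (forall i, measurable (A i)) ->
  lebesgue_rV n [set u | forall i, A i (u ord0 i)] =
  (\prod_(i < n) lebesgue_measure (A i))%E.
Proof.
elim: n => [|n IHn] in A *  => mA.
  rewrite big_ord0 /= diracE mem_set//; by case.
rewrite big_ord_recl /= /lebesgue_cons /pushforward.
rewrite (_ : _ @^-1` _ =
  A ord0 `*` [set u : 'rV[R]_n | forall i, A (lift ord0 i) (u ord0 i)]).
  rewrite product_measure1E//; first by congr mule; exact: IHn.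
  by apply: (@measurable_rV_box _ R n (fun i => A (lift ord0 i))) => i; exact: mA.
apply/seteqP; split => p /=.
  by move=> Ap; split => [|i]; [rewrite -consr0|rewrite -consr_lift].
by move=> [A0 A1] i; case: (unliftP ord0 i) => [j|] ->;
  rewrite ?consr_lift ?consr0.
Qed.

End lebesgue_rV.

Section complex_integral.
Context {R : realType}.
Local Open Scope complex_scope.

Definition expi (t : R) : R[i] := cos t +i* sin t.

Definition cintegral d (T : measurableType d) (mu : {measure set T -> \bar R})
    (f : T -> R[i]) : R[i] :=
  (\int[mu]_x complex.Re (f x)) +i* (\int[mu]_x complex.Im (f x)).

End complex_integral.

Section process.
Context {R : realType} {disp : measure_display} {Omega : measurableType disp}.
Context {P : probability Omega R} {d : nat}.
Implicit Types (xi : 'rV[R]_d -> {RV P >-> R}) (x y : 'rV[R]_d).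

Definition second_order xi := forall x, (xi x : Omega -> R) \in Lfun P 2%:E.

Definition zero_mean xi := forall x, ('E_P[xi x] = 0)%E.

(* [fine] is harmless: the expectation is finite when [xi] is second-order. *)
Definition cov_fun xi x y : R := fine ('E_P[(xi x \* xi y)%R])%E.

Definition continuous_cov xi :=
  continuous (fun p : 'rV[R]_d * 'rV[R]_d => cov_fun xi p.1 p.2).

Definition stationary_cov xi :=
  forall x y x' y', x - y = x' - y' -> cov_fun xi x y = cov_fun xi x' y'.

(* Integrability includes Borel measurability of [S]: a Lebesgue measurable
   density is replaced by an a.e. equal Borel one. *)
Definition spectral_density xi (S : 'rV[R]_d -> R) :=
  [/\ forall u, 0 <= S u,
      (lebesgue_rV d).-integrable setT (EFin \o S) &
      forall x y, ((cov_fun xi x y)%:C =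
        (((2 * pi) ^- d)%:C *
         cintegral (lebesgue_rV d) (fun u => expi (dotr u (x - y)) * (S u)%:C)))%C].

(* Elements of L^2 are represented by square-integrable functions, so the
   projection is determined up to almost sure equality only. *)
Definition fspan n (Y : 'I_n -> Omega -> R) : set (Omega -> R) :=
  [set Z | exists c : 'I_n -> R, Z = fun w => \sum_(i < n) c i * Y i w].

Definition is_orth_proj (V : set (Omega -> R)) (X Z : Omega -> R) :=
  V Z /\ forall W, V W -> ('E_P[((X \- Z) \* W)%R] = 0)%E.

(* Sequences are indexed from 0: [kriging xi s n x] uses s 0, ..., s (n - 1).
   For a second-order process [get] picks one of the almost surely equal
   projections, which always exist because the span is finite-dimensional. *)
Definition kriging xi (s : nat -> 'rV[R]_d) (n : nat) x : Omega -> R :=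
  get (is_orth_proj (fspan (fun i : 'I_n => xi (s i))) (xi x)).

Definition kriging_variance xi (s : nat -> 'rV[R]_d) (n : nat) x : \bar R :=
  ('V_P[(xi x \- kriging xi s n x)%R])%E.

Definition NEB xi := forall (s : nat -> 'rV[R]_d) x,
  closure (range s) x <-> kriging_variance xi s n x @[n --> \oo] --> 0%E.

End process.

(* Main.v *)
(* The kriging variance at x is the minimum over c of the quadratic form of the
   covariance k in the coefficients (1, - c) at the points (x, x_1, ..., x_n), so
   both parts are statements about this form.

   (i) Put T(u) = \prod_i sinc (a u_i)^(2 r).  Then T(u) (1 + |u|^r) is bounded,
   so S dominates a positive multiple of T, and the form of k dominates that of
   the kernel B(x - y) = \int T(u) cos (u . (x - y)) du.  Now B is a tensor product
   of B-splines, supported in a cube of half-side 2 r a: if the x_i stay away from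
   x then, for a small, all the cross terms B(x - x_i) vanish and the form is
   B(0) plus the form of B at the x_i, hence at least B(0) = \int T > 0.

   (ii) On the line through a unit vector, interpolate at the nodes 1 / (i + 2)
   and evaluate at 1.  The Gaussian kernel is diagonalized by the monomials, with
   coefficients (2 alpha)^j / j!.  With nodes in [0, 1] the interpolation error
   for the monomial of degree j lies in [0, 1] and vanishes for j < n, so the
   form is at most a tail of the exponential series. *)

Require Import Defs.
From mathcomp Require Import all_boot all_order all_algebra.
From mathcomp Require Import complex ring lra.
From mathcomp Require Import all_classical all_reals all_analysis.
From mathcomp Require Import measurable_realfun.

Set Implicit Arguments.
Unset Strict Implicit.
Unset Printing Implicit Defensive.

Import Order.TTheory GRing.Theory Num.Theory.
Import numFieldNormedType.Exports.

Local Open Scope classical_set_scope.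
Local Open Scope ring_scope.

(** * Kriging as quadratic minimization *)

Section quadratic_form.
Context {R : realType} {T : Type}.
Implicit Types (k : T -> T -> R) (x : T).

Definition ocons (A : Type) n (a : A) (f : 'I_n -> A) (i : 'I_n.+1) : A :=
  oapp f a (unlift ord0 i).

Lemma ocons0 A n a f : @ocons A n a f ord0 = a.
Proof. by rewrite /ocons unlift_none. Qed.

Lemma ocons_lift A n a f i : @ocons A n a f (lift ord0 i) = f i.
Proof. by rewrite /ocons liftK. Qed.

Definition quad k n (b : 'I_n -> R) (p : 'I_n -> T) : R :=
  \sum_(i < n) \sum_(j < n) b i * b j * k (p i) (p j).

(** When [k] is the covariance, this is the mean square of the residual of the linear predictor with
    coefficients [c]. *)
Definition pred_error k n (c : 'I_n -> R) (p : 'I_n -> T) x : R :=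
  quad k (ocons 1 (fun i => - c i)) (ocons x p).

Definition psd k := forall n (b : 'I_n -> R) p, 0 <= quad k b p.

Lemma quad_ocons k (sk : forall x y, k x y = k y x) n a b x (p : 'I_n -> T) :
  quad k (ocons a b) (ocons x p) =
  a ^+ 2 * k x x + 2 * a * \sum_(i < n) b i * k x (p i) + quad k b p.
Proof.
rewrite /quad big_ord_recl /= big_ord_recl !ocons0.
under [in X in X + _ = _]eq_bigr => j _ do rewrite !ocons_lift.
under [X in _ + X = _]eq_bigr => i _.
  rewrite big_ord_recl !ocons0 !ocons_lift sk.
  under eq_bigr => j _ do rewrite !ocons_lift.
  over.
rewrite /= big_split /= !addrA expr2; congr +%R; rewrite -addrA; congr +%R.
rewrite -big_split /= mulr_sumr; apply: eq_bigr => i _; ring.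
Qed.

Lemma pred_errorE k (sk : forall x y, k x y = k y x) n c (p : 'I_n -> T) x :
  pred_error k c p x =
  k x x - 2 * (\sum_(i < n) c i * k x (p i)) + quad k c p.
Proof.
rewrite /pred_error quad_ocons// expr1n mul1r mulr1; congr (_ + _ + _).
  by rewrite -mulrN -sumrN; congr (_ * _); apply: eq_bigr => i _; rewrite mulNr.
by apply: eq_bigr => i _; apply: eq_bigr => j _; rewrite mulrNN.
Qed.

(** The hypothesis is the system of normal equations. Under it,
    [pred_error k c' p x - pred_error k c p x] equals the form of [k] at [c' - c], which is
    nonnegative. *)
Lemma pred_error_min k (sk : forall x y, k x y = k y x) (k_psd : psd k)
    n c c' (p : 'I_n -> T) x :
  (forall j, k x (p j) = \sum_(i < n) c i * k (p i) (p j)) ->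
  pred_error k c p x <= pred_error k c' p x.
Proof.
move=> cE; rewrite !pred_errorE//.
have E1 a : \sum_(i < n) \sum_(j < n) c i * a j * k (p i) (p j) =
            \sum_(j < n) a j * k x (p j).
  rewrite exchange_big; apply: eq_bigr => j _; rewrite cE mulr_sumr.
  by apply: eq_bigr => i _; ring.
have E2 a : \sum_(i < n) \sum_(j < n) a i * c j * k (p i) (p j) =
            \sum_(j < n) a j * k x (p j).
  rewrite exchange_big -E1; apply: eq_bigr => i _; apply: eq_bigr => j _.
  by rewrite sk; ring.
have := k_psd n (fun i => c' i - c i) p.
have -> : quad k (fun i => c' i - c i) p = quad k c' p -
    (\sum_(i < n) \sum_(j < n) c i * c' j * k (p i) (p j)) -
    (\sum_(i < n) \sum_(j < n) c' i * c j * k (p i) (p j)) + quad k c p.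
  rewrite /quad -!sumrB -big_split; apply: eq_bigr => i _.
  by rewrite -!sumrB -big_split; apply: eq_bigr => j _ /=; ring.
have E3 : quad k c p = \sum_(j < n) c j * k x (p j) := E1 c.
rewrite E1 E2 E3; lra.
Qed.

(** Gram matrices may be singular, for instance when points repeat. The right-hand side is still
    orthogonal to the kernel: on a kernel vector [v] the form at [(1, t v)] is affine in [t] and
    nonnegative, so its slope vanishes. *)
Lemma gram_solvable k (sk : forall x y, k x y = k y x) (k_psd : psd k)
    n (p : 'I_n -> T) x :
  exists c : 'I_n -> R, forall j, k x (p j) = \sum_(i < n) c i * k (p i) (p j).
Proof.
pose G : 'M[R]_n := \matrix_(i, j) k (p i) (p j).
pose g : 'rV[R]_n := \row_j k x (p j).
suff /submxP[D gD] : (g <= G)%MS.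
  exists (D ord0) => j; have := congr1 (fun M : 'rV[R]_n => M ord0 j) gD.
  by rewrite !mxE => ->; apply: eq_bigr => i _; rewrite !mxE.
(* Membership in the row space is tested against the columns of the cokernel, each of which [G]
   annihilates. *)
rewrite submxE; apply/eqP/rowP => j; rewrite [RHS]mxE.
pose v i := cokermx G i j.
have Gv i : \sum_l v l * k (p i) (p l) = 0.
  have := congr1 (fun M : 'M[R]_n => M i j) (mulmx_coker G).
  rewrite [LHS]mxE [RHS]mxE => GK; rewrite -[RHS]GK.
  by apply: eq_bigr => l _; rewrite mxE mulrC.
set be := (g *m cokermx G) ord0 j.
have beE : be = \sum_i v i * k x (p i).
  by rewrite /be mxE; apply: eq_bigr => i _; rewrite mxE mulrC.
have pos t : 0 <= k x x + 2 * t * be.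
  have := k_psd n.+1 (ocons 1 (fun i => t * v i)) (ocons x p).
  rewrite quad_ocons//.
  rewrite [quad _ _ _](_ : _ = 0).
    rewrite expr1n mul1r addr0 mulr1 beE -mulrA [t * _]mulr_sumr.
    by under [in X in _ -> X]eq_bigr => i _ do rewrite mulrA.
  rewrite /quad big1// => i _.
  rewrite (eq_bigr (fun l => t ^+ 2 * v i * (v l * k (p i) (p l)))); last first.
    by move=> l _; ring.
  by rewrite -mulr_sumr Gv mulr0.
apply/eqP/negPn/negP => be0.
(* This [t] makes the affine function equal to [-1]. *)
have := pos (- (k x x + 1) / (2 * be)).
rewrite (_ : 2 * _ * be = - (k x x + 1)); last by field.
lra.
Qed.

End quadratic_form.

(** * The kriging variance as a minimum of the covariance form *)

Section second_order_process.
Context {R : realType} {disp : measure_display} {Omega : measurableType disp}.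
Context {P : probability Omega R} {d : nat} (xi : 'rV[R]_d -> {RV P >-> R}).
Hypotheses (xi_L2 : second_order xi) (xi_mean : zero_mean xi).

Definition comb n (b : 'I_n -> R) (p : 'I_n -> 'rV[R]_d) : Omega -> R :=
  fun w => \sum_(i < n) b i * xi (p i) w.

Lemma Lfun_sum (q : \bar R) (q1 : (1 <= q)%E) n (b : 'I_n -> R)
    (f : 'I_n -> Omega -> R) : (forall i, f i \in Lfun P q) ->
  (fun w => \sum_(i < n) b i * f i w) \in Lfun P q.
Proof.
move=> fL.
elim: n => [|n IH] in b f fL *.
  rewrite (_ : (fun _ => _) = 0); last by apply/funext => w; rewrite big_ord0.
  exact: (Lfun_submod_closed P q1).1.
rewrite (_ : (fun _ => _) = b ord0 *: f ord0 +
    (fun w => \sum_(i < n) b (lift ord0 i) * f (lift ord0 i) w)); last first.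
  by apply/funext => w; rewrite big_ord_recl.
by apply: (Lfun_submod_closed P q1).2 => //; apply: IH.
Qed.

Lemma comb_L2 n b p : @comb n b p \in Lfun P 2%:E.
Proof. by apply: Lfun_sum => //; rewrite lee1n. Qed.

Lemma Lfun21 (f : Omega -> R) : f \in Lfun P 2%:E -> f \in Lfun P 1.
Proof. by apply: Lfun_subset12; exact: fin_num_measure. Qed.

Lemma expectation_lincomb n (b : 'I_n -> R) (f : 'I_n -> Omega -> R) :
  (forall i, f i \in Lfun P 1) ->
  'E_P[(fun w => \sum_(i < n) b i * f i w)%R]%E =
  (\sum_(i < n) b i * fine 'E_P[f i]%E)%:E.
Proof.
move=> fL; elim: n => [|n IH] in b f fL *.
  rewrite big_ord0 (_ : (fun _ => _) = cst 0) ?expectation_cst//.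
  by apply/funext => w; rewrite big_ord0.
rewrite (_ : (fun _ => _) = (b ord0 \o* f ord0)%R \+
    (fun w => \sum_(i < n) b (lift ord0 i) * f (lift ord0 i) w)); last first.
  by apply/funext => w; rewrite big_ord_recl /= mulrC.
rewrite expectationD//; last 2 first.
- exact: Lfun_scale.
- by apply: Lfun_sum => //; rewrite lee1n.
rewrite IH// expectationZl// big_ord_recl EFinD EFinM fineK//.
exact: expectation_fin_num.
Qed.

Local Notation k := (cov_fun xi).

Lemma cov_funC x y : k x y = k y x.
Proof.
rewrite /cov_fun; congr (fine 'E_P[_])%E.
by apply/funext => w /=; rewrite mulrC.
Qed.

Lemma cov_comb n m (b : 'I_n -> R) p (b' : 'I_m -> R) q :
  'E_P[(comb b p \* comb b' q)%R]%E =
  (\sum_(i < n) \sum_(j < m) b i * b' j * k (p i) (q j))%:E.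
Proof.
rewrite (_ : (_ \* _) = fun w => \sum_(i < n) b i *
    (fun w => \sum_(j < m) b' j * (xi (p i) \* xi (q j))%R w) w); last first.
  apply/funext => w; rewrite /comb /= mulr_suml; apply: eq_bigr => i _.
  by rewrite -mulrA mulr_sumr; congr *%R; apply: eq_bigr => j _ /=; rewrite mulrCA.
have xi1 i j : (xi (p i) \* xi (q j))%R \in Lfun P 1 by apply: Lfun2_mul_Lfun1.
rewrite expectation_lincomb; last first.
  by move=> i; apply: Lfun_sum => //; rewrite lexx.
congr EFin; apply: eq_bigr => i _; rewrite expectation_lincomb; last exact: xi1.
rewrite /= mulr_sumr.
by apply: eq_bigr => j _; rewrite mulrA.
Qed.

Lemma cov_fun_psd : psd k.
Proof.
move=> n b p; rewrite -lee_fin /quad -cov_comb; apply: expectation_ge0 => w /=.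
by rewrite -expr2 sqr_ge0.
Qed.

(** The projection picked by [get] satisfies the normal equations, hence minimizes the error. As the
    process is centred, the variance of the residual is its second moment, a value of the covariance
    form. *)
Lemma kriging_varianceP (s : nat -> 'rV[R]_d) n x :
  exists2 c : 'I_n -> R,
    kriging_variance xi s n x = (pred_error k c (fun i => s i) x)%:E &
    forall c', pred_error k c (fun i : 'I_n => s i) x <=
               pred_error k c' (fun i : 'I_n => s i) x.
Proof.
pose p (i : 'I_n) := s i.
have residual c : (xi x \- comb c p)%R =
    comb (ocons 1 (fun i => - c i)) (ocons x p).
  apply/funext => w; rewrite /comb /= big_ord_recl !ocons0 mul1r; congr +%R.
  by rewrite -sumrN; apply: eq_bigr => i _; rewrite !ocons_lift mulNr.
have orthE c c' : ('E_P[((xi x \- comb c p) \* comb c' p)%R] =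
    (\sum_j c' j * (k x (p j) - \sum_i c i * k (p i) (p j)))%:E)%E.
  rewrite residual cov_comb; congr EFin; rewrite exchange_big.
  apply: eq_bigr => j _; rewrite big_ord_recl !ocons0 mul1r mulrBr; congr +%R.
  rewrite mulr_sumr -sumrN; apply: eq_bigr => i _; rewrite !ocons_lift; ring.
have [c0 c0E] := gram_solvable cov_funC cov_fun_psd p x.
(* [get] returns a projection only once one is known to exist. *)
have ex : exists Z, is_orth_proj (P := P) (fspan (fun i : 'I_n => xi (s i))) (xi x) Z.
  exists (comb c0 p); split; first by exists c0.
  move=> _ [c' ->]; apply: (etrans (orthE c0 c')); rewrite big1// => j _.
  by rewrite -c0E subrr mulr0.
have [Z [[c ZE] Zorth]] := ex.
(* The coefficients now belong to the projection picked by [get]; they may differ from [c0] when the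
   Gram matrix is singular. *)
have := getPex ex; rewrite -/(kriging xi s n x) => -[[{c ZE Zorth}c ZE] Zorth].
have cE j : k x (p j) = \sum_i c i * k (p i) (p j).
  (* Orthogonality is tested on the single variable [xi (p j)]. *)
  have := Zorth (comb (fun i => (i == j)%:R) p).
  have W : fspan (fun i : 'I_n => xi (s i)) (comb (fun i => (i == j)%:R) p).
    by exists (fun i => (i == j)%:R).
  move=> /(_ W); rewrite ZE => W0.
  have := EFin_inj (etrans (esym (orthE c _)) W0).
  rewrite (bigD1 j)//= eqxx mul1r [X in _ + X]big1 ?addr0; first exact: subr0_eq.
  by move=> i /negPf ->; rewrite mul0r.
exists c; last by move=> c'; exact: pred_error_min cov_funC cov_fun_psd _ _ _ _ _ cE.
rewrite /kriging_variance ZE residual varianceE ?comb_L2//.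
rewrite [X in (X ^+ 2)%E](_ : _ = 0%E); last first.
  rewrite expectation_lincomb; last by move=> i; exact: Lfun21.
  by rewrite big1// => i _; rewrite xi_mean mulr0.
by rewrite expe2 mule0 sube0 expr2 cov_comb.
Qed.

End second_order_process.

Lemma sqr_enorm {R : realType} {d : nat} (u : 'rV[R]_d) : enorm u ^+ 2 = dotr u u.
Proof.
by rewrite sqr_sqrtr// sumr_ge0// => i _; rewrite -expr2 sqr_ge0.
Qed.

(** * Convergence of the kriging variance to zero *)

Section kriging_convergence.
Context {R : realType} {disp : measure_display} {Omega : measurableType disp}.
Context {P : probability Omega R} {d : nat} (xi : 'rV[R]_d -> {RV P >-> R}).
Hypotheses (xi_L2 : second_order xi) (xi_mean : zero_mean xi).
Local Notation k := (cov_fun xi).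

(** Optimality removes the projection from the argument: to show convergence it suffices to exhibit
    some linear predictors with small error. *)
Lemma kriging_variance_cvg0P (s : nat -> 'rV[R]_d) x :
  kriging_variance xi s n x @[n --> \oo] --> 0%E <->
  forall e, 0 < e -> \forall n \near \oo, exists c : 'I_n -> R,
    pred_error k c (fun i => s i) x < e.
Proof.
split=> [/fine_cvgP[_ kv0] e e0|kv0].
  have /cvgr0Pnorm_lt/(_ _ e0) := kv0.
  apply: filterS => n /=.
  have [c -> _] := kriging_varianceP xi_L2 xi_mean s n x.
  by move=> ce; exists c; exact: le_lt_trans (ler_norm _) ce.
apply/fine_cvgP; split.
  apply: nearW => n.
  by have [c -> _] := kriging_varianceP xi_L2 xi_mean s n x.
apply/cvgr0Pnorm_lt => e e0; move: (kv0 _ e0); apply: filterS => n [c' c'e] /=.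
have [c -> /(_ c') cc'] := kriging_varianceP xi_L2 xi_mean s n x.
by rewrite ger0_norm ?(le_lt_trans cc')//; exact: cov_fun_psd.
Qed.

(** Predicting [xi x] by the single variable [xi (s j)], with [s j] close to [x], already has small
    error by continuity of the covariance. *)
Lemma kriging_variance_adherent (xi_cont : continuous_cov xi)
    (s : nat -> 'rV[R]_d) x :
  closure (range s) x -> kriging_variance xi s n x @[n --> \oo] --> 0%E.
Proof.
move=> sx; apply/kriging_variance_cvg0P => e e0.
pose g y := k x x - 2 * k x y + k y y.
have gx : g x = 0 by rewrite /g; lra.
have gc : g y @[y --> x] --> g x.
  have kc (f : 'rV[R]_d -> 'rV[R]_d * 'rV[R]_d) : f y @[y --> x] --> f x ->
      k (f y).1 (f y).2 @[y --> x] --> k (f x).1 (f x).2.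
    move=> fc; have X := xi_cont (f x).
    exact: (cvg_comp f (fun q => k q.1 q.2) fc X).
  have k1 : k x y @[y --> x] --> k x x.
    apply: (kc (fun y => (x, y))).
    exact: (@cvg_pair _ _ _ (nbhs x) (nbhs x) (nbhs x) _ _ _ (fun=> x) id
      (cvg_cst _) cvg_id).
  have k2 : k y y @[y --> x] --> k x x.
    apply: (kc (fun y => (y, y))).
    exact: (@cvg_pair _ _ _ (nbhs x) (nbhs x) (nbhs x) _ _ _ id id
      cvg_id cvg_id).
  exact: (cvgD (cvgB (cvg_cst _) (cvgM (cvg_cst _) k1)) k2).
have ge : \forall y \near x, g y < e.
  by move: gc; rewrite gx => /cvgr_lt; exact.
have [_ [[j _ <-] gj]] := sx _ ge.
(* The predictor at stage [n] uses [s 0], ..., [s (n - 1)], so [s j] is available from stage [j.+1]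
   on. *)
exists j.+1 => // n /= jn; exists (fun i => (i == j :> nat)%:R).
have := gj; congr (_ < _).
rewrite pred_errorE; last exact: cov_funC.
pose j' := Ordinal jn; congr (_ - 2 * _ + _).
  rewrite (bigD1 j')//= eqxx mul1r big1 ?addr0// => i.
  by rewrite -val_eqE /= => /negPf ->; rewrite mul0r.
rewrite /quad (bigD1 j')//= (bigD1 j')//= eqxx !mul1r.
rewrite !big1 ?addr0//.
  move=> i; rewrite -val_eqE /= => /negPf ij; apply: big1 => l _.
  by rewrite ij !mul0r.
by move=> i; rewrite -val_eqE /= => /negPf ij; rewrite ij mulr0 mul0r.
Qed.

End kriging_convergence.

(** * Gaussian covariance *)

Section newton_interpolation.
Context {R : realType}.
Implicit Types (p : {poly R}) (s : nat -> R).

(* [(p - p.[a]) / ('X - a)], by Horner's scheme *)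
Lemma divided_difference p a : 0 <= a -> (forall i, 0 <= p`_i) ->
  exists q : {poly R}, [/\ forall i, 0 <= q`_i, (size q <= (size p).-1)%N &
    forall t, p.[t] - p.[a] = (t - a) * q.[t]].
Proof.
move=> a0; elim/poly_ind: p => [|p c IH].
  move=> _; exists 0; rewrite size_poly0; split=> // [i|t]; first by rewrite coef0.
  by rewrite !horner0 mulr0 subrr.
move=> pc.
have p_ge0 i : 0 <= p`_i by have := pc i.+1; rewrite coefD coefMX coefC addr0.
have [q [q_ge0 sq qE]] := IH p_ge0.
(* This comes from [t * p.[t] - a * p.[a] = (t - a) * p.[t] + a * (p.[t] - p.[a])]. *)
exists (p + a *: q); split=> [i||t].
- by rewrite coefD coefZ addr_ge0// mulr_ge0.
- have sle : (size (p + a *: q)%R <= size p)%N.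
    rewrite (leq_trans (size_polyD _ _))// geq_max leqnn.
    by rewrite (leq_trans (size_scale_leq _ _))// (leq_trans sq)// leq_pred.
  rewrite size_MXaddC; case: ifP => // /andP[/eqP p0 _].
  by rewrite (leq_trans sle)// p0 size_poly0.
- rewrite !hornerE; have := qE t; set u := q.[t] => E.
  have -> : p.[t] = p.[a] + (t - a) * u by rewrite -E; ring.
  ring.
Qed.

(* [q] is the divided difference [p[s_0, ..., s_(n-1), 'X]]: by Newton's formula
   the left-hand side is the error at [x] of interpolating [p] at the nodes,
   and it decreases with [n] because divided differences at nonnegative nodes
   preserve nonnegative coefficients. *)
Lemma newton_error s (s_ge0 : forall i, 0 <= s i) (s_inj : injective s) n :
  exists c : R -> nat -> R, forall p, (forall i, 0 <= p`_i) ->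
  exists q : {poly R}, [/\ forall i, 0 <= q`_i, (size q <= size p - n)%N,
    forall x, (\prod_(i < n) (x - s i)) * q.[x] =
              p.[x] - \sum_(i < n) c x i * p.[s i] &
    forall x, (forall i, s i <= x) ->
      (\prod_(i < n) (x - s i)) * q.[x] <= p.[x]].
Proof.
elim: n => [|n [c IH]].
  exists (fun _ _ => 0) => p p_ge0; exists p; rewrite subn0; split=> // x.
    by rewrite !big_ord0 mul1r subr0.
  by rewrite big_ord0 mul1r.
pose w x := \prod_(i < n) (x - s i).
have wn : w (s n) != 0.
  apply/prodf_neq0 => i _; rewrite subr_eq0; apply/negP => /eqP /s_inj/esym/eqP.
  by rewrite ltn_eqF.
(* Adding the node [s n] subtracts [w x * q.[s n]] from the error, that is, [w x / w (s n)] times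
   the previous error at [s n]; these coefficients result from expanding it. *)
exists (fun x i => if (i < n)%N then c x i - w x / w (s n) * c (s n) i
                   else w x / w (s n)) => p p_ge0.
have [q [q_ge0 sq qE q_le]] := IH _ p_ge0.
have [q' [q'_ge0 sq' q'E]] := divided_difference (s_ge0 n) q_ge0.
have step x : (\prod_(i < n.+1) (x - s i)) * q'.[x] =
    w x * q.[x] - w x * q.[s n].
  by rewrite big_ord_recr /= -/(w x) -mulrA -q'E mulrBr.
exists q'; split=> // [|x|x sx].
- by rewrite (leq_trans sq')// subnS -!subn1 leq_sub2r.
- rewrite step qE big_ord_recr /= ltnn.
  have -> : w x * q.[s n] = w x / w (s n) * (w (s n) * q.[s n]) by field.
  rewrite qE mulrBr.
  have -> : \sum_(i < n) (if (i < n)%N then c x i - w x / w (s n) * c (s n) i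
                          else w x / w (s n)) * p.[s i] =
      \sum_(i < n) c x i * p.[s i] -
      w x / w (s n) * \sum_(i < n) c (s n) i * p.[s i].
    rewrite mulr_sumr -sumrB; apply: eq_bigr => i _; rewrite ltn_ord; ring.
  ring.
(* The subtracted term is nonnegative: [x] lies to the right of all nodes, and [q] has nonnegative
   coefficients and is evaluated at a nonnegative node. *)
- rewrite step (le_trans _ (q_le _ sx))// gerBl mulr_ge0//.
    by apply: prodr_ge0 => i _; rewrite subr_ge0.
  by rewrite horner_coef sumr_ge0// => i _; rewrite mulr_ge0// exprn_ge0.
Qed.

(** This is [newton_error] at the point 1 for the monomials; the weights there do not depend on the
    polynomial, so one [c] serves every degree [j]. *)
Lemma power_interpolation s (s01 : forall i, 0 <= s i <= 1)
    (s_inj : injective s) n :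
  exists c : nat -> R, forall j,
    0 <= 1 - \sum_(i < n) c i * s i ^+ j <= 1 /\
    ((j < n)%N -> 1 - \sum_(i < n) c i * s i ^+ j = 0).
Proof.
have s0 i : 0 <= s i by case/andP: (s01 i).
have [c cE] := newton_error s0 s_inj n.
exists (c 1) => j.
have [|q [q_ge0 sq qE q_le]] := cE 'X^j; first by move=> i; rewrite coefXn ler0n.
have eE : 1 - \sum_(i < n) c 1 i * s i ^+ j =
    (\prod_(i < n) (1 - s i)) * q.[1].
  rewrite qE hornerXn expr1n; congr (_ - _).
  by apply: eq_bigr => i _; rewrite hornerXn.
rewrite eE; split=> [|jn].
  apply/andP; split; last first.
    rewrite (le_trans (q_le _ _)) ?hornerXn ?expr1n// => i.
    by case/andP: (s01 i).
  rewrite mulr_ge0//.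
    by apply: prodr_ge0 => i _; rewrite subr_ge0; case/andP: (s01 i).
  by rewrite horner_coef sumr_ge0// => i _; rewrite expr1n mulr1.
(* For [j < n] the size [j.+1] of the monomial is at most [n], so the size bound on [q] is zero. *)
have -> : q = 0.
  apply/eqP; rewrite -size_poly_leq0 (leq_trans sq)// size_polyXn.
  by move: jn; rewrite -subn_eq0 => /eqP ->.
by rewrite horner0 mulr0.
Qed.

End newton_interpolation.

(** * Diagonalization of the Gaussian kernel by moments *)

Section gaussian_kernel.
Context {R : realType} (s2 alpha : R).
Hypotheses (s2_ge0 : 0 <= s2) (alpha_ge0 : 0 <= alpha).

Definition gauss_kernel (x y : R) : R := s2 * expR (- alpha * (x - y) ^+ 2).

(* [exp (- alpha (x - y)^2) = exp (- alpha x^2) exp (- alpha y^2)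
   \sum_j (2 alpha)^j / j! x^j y^j] diagonalizes the kernel. *)
Lemma quad_gauss_le n m (b t : 'I_m -> R) :
  (forall j, (\sum_(i < m) b i * expR (- alpha * t i ^+ 2) * t i ^+ j) ^+ 2 <= 1) ->
  (forall j, (j < n)%N ->
     \sum_(i < m) b i * expR (- alpha * t i ^+ 2) * t i ^+ j = 0) ->
  quad gauss_kernel b t <=
    s2 * (expR (2 * alpha) - series (exp_coeff (2 * alpha)) n).
Proof.
set be := fun i => b i * expR (- alpha * t i ^+ 2).
set M := fun j => \sum_(i < m) be i * t i ^+ j => M1 M0.
pose y := 2 * alpha.
have y_ge0 : 0 <= y by rewrite mulr_ge0.
(* The form with the exponential series of [y * t i * t j] cut after [N] terms; [uE] rewrites it as
   a weighted sum of squared moments. *)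
pose u N := \sum_(i < m) \sum_(j < m)
  be i * be j * s2 * series (exp_coeff (y * t i * t j)) N.
have u_cvg : u N @[N --> \oo] --> quad gauss_kernel b t.
  apply: cvg_big => [|i _]; first exact: add_continuous.
  apply: cvg_big => [|j _]; first exact: add_continuous.
  have -> : b i * b j * gauss_kernel (t i) (t j) =
      be i * be j * s2 * expR (y * t i * t j).
    rewrite /gauss_kernel /be /y.
    rewrite (_ : - alpha * (t i - t j) ^+ 2 = - alpha * t i ^+ 2 +
      - alpha * t j ^+ 2 + 2 * alpha * t i * t j); last by ring.
    by rewrite !expRD; ring.
  by apply: cvgM; [exact: cvg_cst|exact: is_cvg_series_exp_coeff].
have uE N : u N = s2 * \sum_(0 <= l < N) exp_coeff y l * M l ^+ 2.
  rewrite /u /series /=.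
  transitivity (\sum_(i < m) \sum_(j < m) \sum_(0 <= l < N)
     s2 * (exp_coeff y l * (be i * t i ^+ l * (be j * t j ^+ l)))).
    apply: eq_bigr => i _; apply: eq_bigr => j _.
    rewrite mulr_sumr; apply: eq_bigr => l _.
    by rewrite /exp_coeff /= !exprMn; ring.
  transitivity (\sum_(i < m) \sum_(0 <= l < N) \sum_(j < m)
     s2 * (exp_coeff y l * (be i * t i ^+ l * (be j * t j ^+ l)))).
    by apply: eq_bigr => i _; exact: exchange_big.
  rewrite exchange_big /= mulr_sumr; apply: eq_bigr => l _.
  rewrite expr2 /M mulr_suml !mulr_sumr; apply: eq_bigr => i _.
  by rewrite !mulr_sumr.
(* Once [n <= N], the first [n] moments contribute nothing and the others at most their exponential
   coefficients. *)
apply: (cvgr_to_le u_cvg); near=> N; rewrite uE ler_wpM2l//.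
have nN : (n <= N)%N by near: N; exists n.
apply: (@le_trans _ _ (series (exp_coeff y) N - series (exp_coeff y) n)).
  have catE (F : nat -> R) : \sum_(0 <= l < N) F l =
      \sum_(0 <= l < n) F l + \sum_(n <= l < N) F l by exact: big_cat_nat.
  rewrite /series /= !catE [X in X + _ <= _]big_nat_cond big1.
    rewrite add0r addrAC subrr add0r; apply: ler_sum => l _.
    by rewrite -[leRHS]mulr1 ler_wpM2l ?exp_coeff_ge0// M1.
  by move=> l /andP[/andP[_ ln] _]; rewrite (M0 _ ln : M l = 0) expr0n mulr0.
rewrite lerD2r; apply: nondecreasing_cvgn_le.
  by apply: nondecreasing_series => l _ _; exact: exp_coeff_ge0.
exact: is_cvg_series_exp_coeff.
Unshelve. all: by end_near. Qed.

End gaussian_kernel.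

(** * Failure of the NEB property for the Gaussian covariance *)

Section gaussian_process.
Context {R : realType} {disp : measure_display} {Omega : measurableType disp}.
Context {P : probability Omega R} {d : nat} (d_gt0 : (0 < d)%N).
Context (xi : 'rV[R]_d -> {RV P >-> R}).
Hypotheses (xi_L2 : second_order xi) (xi_mean : zero_mean xi).
Local Notation k := (cov_fun xi).

Let i0 : 'I_d := Ordinal d_gt0.
Let e0 : 'rV[R]_d := delta_mx ord0 i0.
(** The shift by two keeps every node in [[0, 1/2]], away from the evaluation point 1. *)
Let node (n : nat) : R := n.+2%:R^-1.

Lemma gaussian_not_NEB s alpha : 0 < s -> 0 < alpha ->
  (forall x y, k x y = s ^+ 2 * expR (- alpha * enorm (x - y) ^+ 2)) ->
  ~ NEB xi.
Proof.
move=> s0 al0 kE neb.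
have node01 i : 0 <= node i <= 1.
  by rewrite invr_ge0 ler0n /= invf_le1 ?ler1n.
have node_inj : injective node by move=> i j /invr_inj/eqP; rewrite eqr_nat => /eqP[].
have kline (a b : R) : k (a *: e0) (b *: e0) = gauss_kernel (s ^+ 2) alpha a b.
  rewrite kE /gauss_kernel sqr_enorm -scalerBl; congr (_ * expR (_ * _)).
  rewrite /dotr (bigD1 i0)//= big1 ?addr0 => [|i /negPf ii0].
    by rewrite !mxE !eqxx mulr1 expr2.
  by rewrite !mxE ii0 andbF mulr0 mul0r.
have /neb cl0 : kriging_variance xi (fun n => node n *: e0) n e0 @[n --> \oo] --> 0%E.
  apply/(kriging_variance_cvg0P xi_L2 xi_mean) => e e_gt0.
  have tail : s ^+ 2 * (expR (2 * alpha) - series (exp_coeff (2 * alpha)) n)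
      @[n --> \oo] --> (0 : R).
    have := is_cvg_series_exp_coeff (2 * alpha).
    move=> /(cvgB (cvg_cst (expR (2 * alpha))))/(cvgM (cvg_cst (s ^+ 2))).
    by rewrite subrr mulr0.
  move: tail => /cvgr_lt/(_ _ e_gt0); apply: filterS => n tail_lt.
  have [c cE] := power_interpolation node01 node_inj n.
  (* The factor cancels the Gaussian weight at the node against that at 1, so that the moments of
     [b] are [expR (- alpha)] times the interpolation errors of the monomials. *)
  pose c' (i : 'I_n) := c i * expR (- alpha + alpha * node i ^+ 2).
  exists c'; apply: le_lt_trans tail_lt.
  pose b := ocons 1 (fun i => - c' i); pose t := ocons 1 (fun i : 'I_n => node i).
  have -> : pred_error k c' (fun i => node i *: e0) e0 =
      quad (gauss_kernel (s ^+ 2) alpha) b t.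
    rewrite /pred_error /quad; apply: eq_bigr => i _; apply: eq_bigr => j _.
    rewrite -kline; congr (_ * k _ _); rewrite /t.
      case: (unliftP ord0 i) => [i'|] ->; first by rewrite !ocons_lift.
      by rewrite !ocons0 scale1r.
    case: (unliftP ord0 j) => [j'|] ->; first by rewrite !ocons_lift.
    by rewrite !ocons0 scale1r.
  have momentE j : \sum_(i < n.+1) b i * expR (- alpha * t i ^+ 2) * t i ^+ j =
      expR (- alpha) * (1 - \sum_(i < n) c i * node i ^+ j).
    rewrite big_ord_recl /b /t !ocons0 mul1r !expr1n !mulr1 mulrBr mulr1 mulr_sumr.
    rewrite -sumrN; congr +%R; apply: eq_bigr => i _; rewrite !ocons_lift /c'.
    have -> : expR (- alpha) = expR (- alpha + alpha * node i ^+ 2) *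
        expR (- alpha * node i ^+ 2) by rewrite -expRD; congr expR; ring.
    ring.
  apply: quad_gauss_le => [||j|j jn].
  - exact: sqr_ge0.
  - exact: ltW.
  - have /andP[e1 e2] := (cE j).1.
    rewrite momentE expr_le1//; last first.
      by rewrite mulr_ge0// expR_ge0.
    by rewrite mulr_ile1 ?expR_ge0// -expR0 ler_expR oppr_le0 ltW.
  - by rewrite momentE (cE j).2// mulr0.
(* NEB would put some node in the ball of radius 1/2 around [e0]; its coordinate [i0] gives the
   contradiction. *)
have [_ [[n _ <-] /=]] := cl0 _ (nbhsx_ballx e0 (2^-1) (ltac:(by rewrite invr_gt0))).
rewrite /ball /= /mx_ball => -[_ /(_ ord0 i0)].
rewrite !mxE !eqxx mulr1 /ball /= => node1.
have n2 : node n <= 2^-1 by rewrite lef_pV2 ?posrE// ler_nat.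
have n1 : 1 - node n < 2^-1 := le_lt_trans (ler_norm _) node1.
have : (2^-1 : R) + 2^-1 = 1 by field.
lra.
Qed.

End gaussian_process.

(** * Compactly supported Fourier transforms *)

Section integrable_product.
Context d1 d2 (T1 : measurableType d1) (T2 : measurableType d2) (R : realType).
Context (m1 : {sigma_finite_measure set T1 -> \bar R})
        (m2 : {sigma_finite_measure set T2 -> \bar R}).

Lemma integrable_prod (f : T1 -> R) (g : T2 -> R) :
  m1.-integrable setT (EFin \o f) -> m2.-integrable setT (EFin \o g) ->
  (m1 \x m2)%E.-integrable setT (EFin \o (fun p : T1 * T2 => f p.1 * g p.2)).
Proof.
move=> /integrableP[mf fi] /integrableP[mg gi].
have mf' : measurable_fun setT f by exact/measurable_EFinP.
have mg' : measurable_fun setT g by exact/measurable_EFinP.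
apply/integrable12ltyP.
  by apply/measurable_EFinP; apply: measurable_funM; exact: measurableT_comp.
rewrite (eq_integral (fun x => `|(EFin \o f) x| * \int[m2]_y `|(EFin \o g) y|)%E);
    last first.
  move=> x _; rewrite -ge0_integralZl//; last exact: measurableT_comp.
  by apply: eq_integral => y _ /=; rewrite normrM EFinM.
rewrite ge0_integralZr//; last 2 first.
- exact: measurableT_comp.
- exact: integral_ge0.
by rewrite lte_mul_pinfty ?integral_ge0// ge0_fin_numE// integral_ge0.
Qed.

End integrable_product.

(** * Cosine integrals and multiplication by [sinc] *)

Section oscillatory_integrals.
Context {R : realType}.
Local Notation mu := (@lebesgue_measure R).
Implicit Types (h : R -> R) (a t th : R).

Lemma measurable_cos : measurable_fun [set: R] (@cos R).
Proof. by apply: continuous_measurable_fun => x; exact: continuous_cos. Qed.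

(** The free phase [th] later absorbs the contribution of the other coordinates when integrating one
    coordinate at a time. *)
Definition osc h t th : R := \int[mu]_u (h u * cos (u * t + th)).

Definition sinc a u : R := if u == 0 then 1 else sin (a * u) / (a * u).

Lemma sinc_le1 a u : `|sinc a u| <= 1.
Proof.
rewrite /sinc; case: ifPn => [_|_]; first by rewrite normr1.
have [->|v0] := eqVneq (a * u) 0; first by rewrite invr0 mulr0 normr0.
rewrite normrM normfV ler_pdivrMr ?normr_gt0// mul1r.
wlog v_gt0 : u v0 / 0 < a * u => [H|].
  have [/H|] := ltP 0 (a * u); first exact.
  rewrite le_eqVlt (negPf v0) /= => v_lt0.
  by have := H (- u); rewrite mulrN sinN !normrN oppr_eq0 oppr_gt0; exact.
have cs : {within `[0, a * u], continuous (@sin R)}.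
  by apply: continuous_subspaceT => x; exact: continuous_sin.
have [c _] := MVT v_gt0 (fun x _ => is_derive_sin x) cs.
rewrite sin0 !subr0 => ->; rewrite normrM ler_piMl//.
exact: cos_max.
Qed.

(** The square of [sinc a u] is at most 1, and that of [u * sinc a u] at most [(a ^+ 2)^-1]. This
    decay makes even powers integrable. *)
Lemma sinc_sqr_le a u : 0 < a ->
  sinc a u ^+ 2 <= (1 + (a ^+ 2)^-1) * (oneDsqr u)^-1.
Proof.
move=> a0; rewrite ler_pdivlMr; last exact: lt_le_trans ltr01 (oneDsqr_ge1 _).
rewrite /oneDsqr mulrDr mulr1 lerD//.
  by rewrite -real_normK ?num_real// expr_le1// sinc_le1.
rewrite -exprMn /sinc; case: ifPn => [/eqP ->|u0].
  by rewrite mulr0 expr0n invr_ge0 sqr_ge0.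
have -> : sin (a * u) / (a * u) * u = sin (a * u) * a^-1.
  by field; rewrite u0 gt_eqF.
by rewrite exprMn exprVn ler_piMl ?invr_ge0 ?sqr_ge0// sin2cos2 gerBl sqr_ge0.
Qed.

Lemma measurable_sinc a : measurable_fun [set: R] (sinc a).
Proof.
apply: measurable_fun_if => //; first exact: measurable_fun_eqr.
rewrite setTI (_ : _ @^-1` _ = ~` [set 0]); last first.
  by apply/seteqP; split => u /=; [move/negbT/eqP|move/eqP/negPf].
apply: open_continuous_measurable_fun.
  exact/closed_openC/accessible_closed_set1/hausdorff_accessible.
move=> u; rewrite inE /= => /eqP u0.
have [->|a0] := eqVneq a 0.
  under [X in continuous_at _ X]eq_fun do rewrite !mul0r sin0 mul0r.
  exact: cvg_cst.
have au0 : a * u != 0 by rewrite mulf_neq0.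
have auc : {for u, continuous (fun v : R => a * v)}.
  by apply: cvgM; [exact: cvg_cst|exact: cvg_id].
apply: cvgM; last exact: cvgV.
apply: (@continuous_comp _ _ _ (fun v : R => a * v) (@sin R)) => //.
exact: continuous_sin.
Qed.

Lemma integral_derive (F f : R -> R) (a b : R) : a < b ->
  continuous f -> (forall y : R, is_derive y 1 F (f y)) ->
  (\int[mu]_(y in `[a, b]) (f y)%:E = (F b - F a)%:E)%E.
Proof.
move=> ab cf dF.
have cF y : {for y, continuous F}.
  by apply/differentiable_continuous/derivable1_diffP.
rewrite (@continuous_FTC2 _ f F)//.
- exact: continuous_subspaceT.
- split=> [y _||]; first exact: ex_derive.
  + by apply: cvg_at_right_filter; exact: cF.
  + by apply: cvg_at_left_filter; exact: cF.
- by move=> y _; rewrite derive1E; exact: derive_val.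
Qed.

Lemma continuous_cos_affine (u th : R) : continuous (fun y : R => cos (u * y + th)).
Proof.
move=> y; apply: (@continuous_comp _ _ _ (fun y : R => u * y + th)).
  by apply: cvgD; [apply: cvgM; [exact: cvg_cst|exact: cvg_id]|exact: cvg_cst].
exact: continuous_cos.
Qed.

(* [sinc] is the Fourier transform of a uniform density on [[- a, a]], so
   multiplying by it averages the transform over an interval. *)
Lemma sinc_cos (a u t th : R) : 0 < a ->
  (\int[mu]_(y in `[(t - a)%R, (t + a)%R]) (cos (u * y + th))%R%:E =
   (2 * a * (sinc a u * cos (u * t + th)))%R%:E)%E.
Proof.
move=> a0; have tt : t - a < t + a by lra.
have [->|u0] := eqVneq u 0.
  rewrite /sinc eqxx !mul0r add0r mul1r.
  under eq_integral do rewrite mul0r add0r.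
  rewrite integral_cst//= lebesgue_measure_itv/= lte_fin tt -EFinB -EFinM.
  congr EFin; ring.
have dF (y : R) : is_derive y 1 (fun y => sin (u * y + th) / u) (cos (u * y + th)).
  apply: is_derive_eq.
  by rewrite /GRing.scale /=; field.
rewrite (integral_derive tt (@continuous_cos_affine u th) dF).
rewrite /sinc (negPf u0); congr EFin.
have -> : u * (t + a) + th = (u * t + th) + a * u by ring.
have -> : u * (t - a) + th = (u * t + th) - a * u by ring.
by rewrite sinB sinD; field; rewrite u0 gt_eqF.
Qed.

Lemma osc_integrable h t th : mu.-integrable setT (EFin \o h) ->
  mu.-integrable setT (EFin \o (fun u => h u * cos (u * t + th))).
Proof.
move=> hi; apply: (le_integrable _ _ _ hi) => //.
  apply/measurable_EFinP; apply: measurable_funM.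
    by apply/measurable_EFinP; exact: measurable_int hi.
  apply: measurableT_comp; first exact: measurable_cos.
  by apply: measurable_funD => //; exact: measurable_funM.
move=> u _ /=; rewrite lee_fin normrM ler_piMr//.
exact: cos_max.
Qed.

Lemma integrable_sinc h a : mu.-integrable setT (EFin \o h) ->
  mu.-integrable setT (EFin \o (fun u => h u * sinc a u)).
Proof.
move=> hi; apply: (le_integrable _ _ _ hi) => //.
  apply/measurable_EFinP; apply: measurable_funM; last exact: measurable_sinc.
  by apply/measurable_EFinP; exact: measurable_int hi.
by move=> u _ /=; rewrite lee_fin normrM ler_piMr// sinc_le1.
Qed.

Lemma EFin_osc h t th : mu.-integrable setT (EFin \o h) ->
  ((osc h t th)%:E = \int[mu]_u (h u * cos (u * t + th))%R%:E)%E.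
Proof.
by move=> hi; rewrite fineK//; apply: integrable_fin_num => //; exact: osc_integrable.
Qed.

(** By [sinc_cos] and Fubini, the transform of [h * sinc a] at [t] is the average of that of [h]
    over [[t - a, t + a]], where [r <= |y|] still holds. *)
Lemma osc_sinc_bound h a r K : 0 < a -> mu.-integrable setT (EFin \o h) ->
  (forall y th, r <= `|y| -> `|osc h y th| <= K) ->
  forall t th, r + a <= `|t| -> `|osc (fun u => h u * sinc a u) t th| <= K.
Proof.
move=> a0 hi hK t th rt.
have mh : measurable_fun setT h.
  by apply/measurable_EFinP; exact: measurable_int hi.
have K0 : 0 <= K.
  by apply: le_trans (hK `|r| 0 _); rewrite ?normr_id// ler_norm.
pose J := `[t - a, t + a]%classic.
have mJ : measurable J by exact: measurable_itv.
have muJ : (mu J = (2 * a)%:E)%E.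
  rewrite /J lebesgue_measure_itv/= lte_fin; have -> : t - a < t + a by lra.
  rewrite -EFinB; congr EFin; ring.
pose GR := measurableTypeR R.
(* The indicator of [J] turns the average over an interval into an integral over the whole plane, as
   Fubini requires. *)
pose f (p : GR * GR) : R := h p.1 * \1_J p.2 * cos (p.1 * p.2 + th).
have fi : (mu \x mu)%E.-integrable setT (EFin \o f).
  have hJi : (mu \x mu)%E.-integrable setT
      (EFin \o (fun p : GR * GR => h p.1 * \1_J p.2)).
    by apply: integrable_prod => //; exact: integrable_indic_itv.
  apply: (le_integrable _ _ _ hJi) => //.
    apply/measurable_EFinP; apply: measurable_funM.
      by apply/measurable_EFinP; exact: measurable_int hJi.
    apply: measurableT_comp; first exact: measurable_cos.
    by apply: measurable_funD => //; exact: measurable_funM.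
  by move=> p _ /=; rewrite lee_fin normrM ler_piMr// cos_max.
pose G y := (\1_J y * osc h y th)%R%:E.
have GE : fubini_G mu (EFin \o f) = G.
  apply/funext => y; rewrite /fubini_G /G EFinM EFin_osc//.
  rewrite -integralZl//; last exact: osc_integrable.
  by apply: eq_integral => x _; rewrite /f /= -EFinM; congr EFin; ring.
have mG : measurable_fun setT G by rewrite -GE; exact: (measurable_fubini_G fi).
have E1 : (osc (fun u => h u * sinc a u) t th * (2 * a))%:E = (\int[mu]_y G y)%E.
  rewrite EFinM EFin_osc; last exact: integrable_sinc.
  rewrite -integralZr//; last exact/osc_integrable/integrable_sinc.
  rewrite -GE -(Fubini fi); apply: eq_integral => x _.
  rewrite -EFinM.
  have -> : h x * sinc a x * cos (x * t + th) * (2 * a) =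
    h x * (2 * a * (sinc a x * cos (x * t + th))) by ring.
  rewrite EFinM -sinc_cos// -/J -integralZl//; last first.
    apply: continuous_compact_integrable; first exact: segment_compact.
    by apply: continuous_subspaceT; exact: continuous_cos_affine.
  rewrite integral_mkcond; apply: eq_integral => y _.
  by rewrite epatch_indic /f /= -!EFinM; congr EFin; ring.
rewrite -(@ler_pM2r _ (2 * a)) ?mulr_gt0//.
rewrite -[X in _ * X <= _]gtr0_norm ?mulr_gt0// -normrM -lee_fin -abse_EFin E1.
apply: (le_trans (le_abse_integral _ _ _)) => //.
apply: (@le_trans _ _ (\int[mu]_y (K%:E * (\1_J y)%:E))%E).
  apply: ge0_le_integral => //.
  - exact: measurableT_comp.
  - by apply/measurable_EFinP; exact: measurable_funM.
  move=> y _; rewrite /G -EFinM lee_fin indicE normrM [leRHS]mulrC.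
  have [yJ|yJ] := boolP (y \in J); last by rewrite normr0 !mul0r.
  rewrite normr1 !mul1r hK//.
  move: yJ; rewrite inE /J /= in_itv /= => /andP[y1 y2].
  have : `|t| <= `|y| + a.
    rewrite -[X in _ + X]gtr0_norm//.
    have [t0|t0] := leP 0 t.
      rewrite (ger0_norm t0) (gtr0_norm a0). have := ler_norm y; lra.
    rewrite (ltr0_norm t0) (gtr0_norm a0). have := ler_norm (- y); rewrite normrN; lra.
  lra.
rewrite ge0_integralZl_EFin//; last exact/measurable_EFinP.
by rewrite integral_indic// setIT EFinM -muJ.
Qed.

End oscillatory_integrals.

(** * Compact support of the transform of sinc powers *)

Section sinc_powers.
Context {R : realType}.
Local Notation mu := (@lebesgue_measure R).
Implicit Types (a t th L u del : R).

(* Any cut-off with an explicit, decaying oscillatory integral would do. *)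
Definition window L u : R := (1 - u ^+ 2 / L ^+ 2) * \1_(`[- L, L]%classic) u.

Lemma window_ge0 L u : 0 < L -> 0 <= window L u.
Proof.
move=> L0; rewrite /window indicE; have [|_] := boolP (u \in _); last by rewrite mulr0.
rewrite inE /= in_itv /= mulr1 -ler_norml subr_ge0 => uL.
rewrite ler_pdivrMr ?exprn_gt0// mul1r -real_normK ?num_real//.
by rewrite lerXn2r// nnegrE ?ltW.
Qed.

Lemma window_le1 L u : 0 < L -> window L u <= 1.
Proof.
move=> L0; rewrite /window indicE; case: (_ \in _); last by rewrite mulr0.
by rewrite mulr1 gerBl mulr_ge0// ?invr_ge0 ?sqr_ge0.
Qed.

Lemma measurable_window L : measurable_fun setT (window L).
Proof.
apply: measurable_funM; last exact: measurable_indic.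
by apply: measurable_funB => //; exact: measurable_funM.
Qed.

Lemma integrable_window L : 0 < L -> mu.-integrable setT (EFin \o window L).
Proof.
move=> L0.
have := @integrable_indic_itv R (- L) L true false.
move=> /(le_integrable _ _ _); apply => //.
  by apply/measurable_EFinP; exact: measurable_window.
move=> u _ /=; rewrite lee_fin ger0_norm ?window_ge0//.
rewrite ger0_norm ?indicE//.
have := window_le1 u L0; rewrite /window indicE.
by case: (_ \in _); rewrite // mulr0.
Qed.

(** The cut-off vanishes at [- L] and [L], so after integration by parts the boundary term of order
    one drops out; the rest is of order [1 / L], uniformly over [del <= |t|]. *)
Lemma osc_window del t th L : 0 < del -> del <= `|t| -> 1 <= L ->
  `|osc (window L) t th| <= (4 / del ^+ 2 + 4 / del ^+ 3) / L.
Proof.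
move=> del0 delt L1.
have t0 : t != 0 by rewrite -normr_gt0 (lt_le_trans del0).
have L0 : 0 < L by exact: lt_le_trans L1.
(* An antiderivative found by repeated integration by parts, which terminates because the cut-off is
   quadratic. *)
pose F u := (1 - u ^+ 2 / L ^+ 2) * (sin (u * t + th) / t) -
  2 * u / L ^+ 2 * (cos (u * t + th) / t ^+ 2) + 2 / L ^+ 2 * (sin (u * t + th) / t ^+ 3).
have dF (u : R) : is_derive u 1 F ((1 - u ^+ 2 / L ^+ 2) * cos (u * t + th)).
  rewrite /F; apply: is_derive_eq.
  by rewrite /GRing.scale /=; field; rewrite t0 gt_eqF.
have cf : continuous (fun u : R => (1 - u ^+ 2 / L ^+ 2) * cos (u * t + th)).
  move=> u; apply: cvgM.
    apply: cvgB; first exact: cvg_cst.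
    by apply: cvgM; [exact: exprn_continuous|exact: cvg_cst].
  have := @continuous_cos_affine R t th u.
  by under eq_fun do rewrite mulrC.
have -> : osc (window L) t th = F L - F (- L).
  apply: EFin_inj; rewrite EFin_osc; last exact: integrable_window.
  have LL : - L < L by lra.
  rewrite -(integral_derive LL cf dF).
  rewrite [RHS]integral_mkcond; apply: eq_integral => u _.
  by rewrite epatch_indic /window /= -EFinM; congr EFin; ring.
set A := L * t + th; set B := - L * t + th.
have -> : F L - F (- L) = - (2 * (cos A + cos B)) / L / t ^+ 2 +
    2 * (sin A - sin B) / L ^+ 2 / t ^+ 3.
  by rewrite /F -/A -/B; field; rewrite t0 gt_eqF.
have c2 : `|2 * (cos A + cos B)| <= 4.
  rewrite normrM ger0_norm//; have := ler_normD (cos A) (cos B).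
  by have := cos_max A; have := cos_max B; lra.
have s2 : `|2 * (sin A - sin B)| <= 4.
  rewrite normrM ger0_norm//; have := ler_normB (sin A) (sin B).
  by have := sin_max A; have := sin_max B; lra.
have tV n : `|(t ^+ n)^-1| <= (del ^+ n)^-1.
  rewrite normfV normrX lef_pV2 ?posrE ?exprn_gt0// ?(lt_le_trans del0)//.
  by rewrite lerXn2r// nnegrE ltW// (lt_le_trans del0).
have bound x y n : `|x| <= 4 -> `|y| <= L^-1 ->
    `|x * y / t ^+ n| <= 4 / del ^+ n / L.
  move=> x4 yL; rewrite !normrM [leRHS]mulrAC.
  by apply: ler_pM; rewrite ?mulr_ge0//; apply: ler_pM.
rewrite (le_trans (ler_normD _ _))// [leRHS]mulrDl lerD// bound ?normrN//.
  by rewrite ger0_norm// invr_ge0 ltW.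
rewrite ger0_norm ?invr_ge0 ?sqr_ge0//.
by rewrite lef_pV2 ?posrE ?exprn_gt0// expr2 ler_pMl.
Qed.

Lemma window_cvg1 u : window N.+1%:R u @[N --> \oo] --> (1 : R).
Proof.
have w1 : 1 - u ^+ 2 / N.+1%:R ^+ 2 @[N --> \oo] --> (1 : R).
  rewrite -[X in _ --> X]subr0; apply: cvgB; first exact: cvg_cst.
  rewrite -(mulr0 (u ^+ 2)); apply: cvgM; first exact: cvg_cst.
  rewrite -(mulr0 0); under eq_fun do rewrite expr2 invfM.
  by apply: cvgM; exact: cvg_harmonic.
apply: cvg_trans w1; apply: near_eq_cvg; near=> N.
rewrite /window indicE mem_set ?mulr1// /= in_itv /= -ler_norml.
rewrite ltW// (lt_le_trans (truncnS_gt _))// ler_nat ltnS.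
by near: N; exists (Num.truncn `|u|).
Unshelve. all: by end_near. Qed.

(** By [osc_sinc_bound], each factor [sinc a] enlarges the excluded radius by [a] and leaves the
    bound unchanged. *)
Lemma osc_window_sinc n a del t th L : 0 < a -> 0 < del -> 1 <= L ->
  n%:R * a + del <= `|t| ->
  `|osc (fun u => window L u * sinc a u ^+ n) t th| <=
    (4 / del ^+ 2 + 4 / del ^+ 3) / L.
Proof.
move=> a0 del0 L1; have L0 : 0 < L by exact: lt_le_trans L1.
suff [_ H] : mu.-integrable setT (EFin \o (fun u => window L u * sinc a u ^+ n)) /\
    forall t th, n%:R * a + del <= `|t| ->
      `|osc (fun u => window L u * sinc a u ^+ n) t th| <=
      (4 / del ^+ 2 + 4 / del ^+ 3) / L by exact: H.
elim: n => [|n [IHi IH]].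
  have -> : (fun u => window L u * sinc a u ^+ 0) = window L.
    by apply/funext => u; rewrite expr0 mulr1.
  split; first exact: integrable_window.
  by move=> t' th'; rewrite mul0r add0r => delt; exact: osc_window.
have -> : (fun u => window L u * sinc a u ^+ n.+1) =
    (fun u => window L u * sinc a u ^+ n * sinc a u).
  by apply/funext => u; rewrite exprSr mulrA.
split; first exact: integrable_sinc.
move=> t' th' tn; apply: (osc_sinc_bound a0 IHi IH).
by move: tn; rewrite -natr1; lra.
Qed.

Lemma integrable_oneDsqrV : mu.-integrable setT (EFin \o (fun u => (oneDsqr u)^-1)).
Proof.
apply/integrableP; split.
  by apply/measurable_EFinP; apply: continuous_measurable_fun; exact: continuous_oneDsqrV.
under eq_integral => u _.
  rewrite gee0_abs; last by rewrite lee_fin invr_ge0.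
  over.
rewrite ge0_symfun_integralT//=.
- rewrite (_ : [set x | 0 <= x] = `[0, +oo[%classic); last first.
    by apply/seteqP; split => x /=; rewrite in_itv /= andbT.
  by rewrite integral0y_oneDsqr -EFinM ltry.
- exact: continuous_oneDsqrV.
- by move=> x /=; rewrite /oneDsqr sqrrN.
Qed.

Lemma integrable_sinc_pow a r : 0 < a -> (0 < r)%N ->
  mu.-integrable setT (EFin \o (fun u => sinc a u ^+ (2 * r))).
Proof.
move=> a0 r0.
have := integrableZl (measurableT : measurable [set: measurableTypeR R])
  (1 + (a ^+ 2)^-1) integrable_oneDsqrV.
apply: le_integrable => //.
  by apply/measurable_EFinP; apply: measurable_funX; exact: measurable_sinc.
have s2_ge0 u : 0 <= sinc a u ^+ 2 by exact: sqr_ge0.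
move=> u _ /=; rewrite lee_fin exprM (ger0_norm (exprn_ge0 _ (s2_ge0 u))).
rewrite [leRHS]ger0_norm; last first.
  by rewrite mulr_ge0 ?addr_ge0 ?invr_ge0 ?sqr_ge0.
rewrite (le_trans _ (sinc_sqr_le u a0))//.
apply: ler_iXnr => //.
by rewrite -real_normK ?num_real// expr_le1// sinc_le1.
Qed.

(* [sinc ^+ n] is the Fourier transform of an [n]-fold convolution of uniform
   densities on [[- a, a]], supported in [[- n a, n a]]. *)
Lemma osc_sinc_pow r a t th : 0 < a -> (0 < r)%N -> (2 * r)%:R * a < `|t| ->
  osc (fun u => sinc a u ^+ (2 * r)) t th = 0.
Proof.
move=> a0 r0 rat; set n := (2 * r)%N.
pose del := `|t| - n%:R * a.
have del0 : 0 < del by rewrite subr_gt0.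
pose K := 4 / del ^+ 2 + 4 / del ^+ 3.
(* The induction over the factors cannot start from the constant 1, which is not integrable; the
   window is removed in the limit. *)
pose f N u := window N.+1%:R u * sinc a u ^+ n.
have L0 N : 0 < N.+1%:R :> R by [].
have fK N : `|osc (f N) t th| <= K / N.+1%:R.
  by apply: osc_window_sinc => //; [rewrite ler1n|rewrite /del; lra].
have gi := integrable_sinc_pow a0 r0.
(* The same sequence has two limits: dominated convergence gives the transform of the sinc power,
   and [fK] gives zero. *)
have osc_cvg : osc (f N) t th @[N --> \oo] --> osc (fun u => sinc a u ^+ n) t th.
  have h0 (x : R) (N : nat) : `|f N x * cos (x * t + th)| <= `|sinc a x ^+ n|.
    rewrite normrM (le_trans (ler_piMr _ (cos_max _)))// /f normrM ler_piMl//.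
    by rewrite ger0_norm ?window_ge0 ?window_le1.
  have mf N : measurable_fun setT (fun x => f N x * cos (x * t + th)).
    apply: measurable_funM.
      apply: measurable_funM; first exact: measurable_window.
      by apply: measurable_funX; exact: measurable_sinc.
    apply: measurableT_comp; first exact: measurable_cos.
    by apply: measurable_funD => //; exact: measurable_funM.
  have fi N : mu.-integrable setT (EFin \o (fun x => f N x * cos (x * t + th))).
    apply: (le_integrable _ _ _ gi) => //.
      by apply/measurable_EFinP; exact: mf.
    by move=> x _; rewrite lee_fin; exact: h0.
  apply: fine_cvg; rewrite EFin_osc//.
  apply: (@dominated_cvg _ _ _ mu setT measurableT
    (fun N x => (f N x * cos (x * t + th))%:E) _
    (fun x => `|sinc a x ^+ n|%:E)) => //.
  - by move=> N; apply/measurable_EFinP; exact: mf.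
  - move=> x _; apply: cvg_EFin; first exact: nearW.
    apply: cvgM; last exact: cvg_cst.
    rewrite -[X in _ --> X]mul1r; apply: cvgM; last exact: cvg_cst.
    exact: window_cvg1.
  - by have := integrable_norm gi.
  - by move=> N x _; rewrite lee_fin; exact: h0.
have osc0 : osc (f N) t th @[N --> \oo] --> (0 : R).
  have K0 : K / N.+1%:R @[N --> \oo] --> (0 : R).
    rewrite -(mulr0 K); apply: cvgM; first exact: cvg_cst.
    exact: cvg_harmonic.
  apply: norm_cvg0; apply: (squeeze_cvgr _ (cvg_cst 0) K0).
  by apply: nearW => N; rewrite normr_ge0 fK.
exact: cvg_unique osc_cvg osc0.
Qed.

End sinc_powers.

(** * Tensor products, integrated one coordinate at a time *)

Section tensor_product.
Context {R : realType} (g : R -> R).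
Local Notation mu := (@lebesgue_measure R).
Hypothesis g_int : mu.-integrable setT (EFin \o g).

Definition tensor n (u : 'rV[R]_n) : R := \prod_(i < n) g (u ord0 i).

Definition rV_behead n (z : 'rV[R]_n.+1) : 'rV[R]_n :=
  \row_j z ord0 (lift ord0 j).

Lemma tensor_consr n p : tensor (@consr R n p) = g p.1 * tensor p.2.
Proof.
rewrite /tensor big_ord_recl consr0; congr *%R.
by apply: eq_bigr => i _; rewrite consr_lift.
Qed.

Lemma dotr_consr n p z :
  dotr (@consr R n p) z = p.1 * z ord0 ord0 + dotr p.2 (rV_behead z).
Proof.
rewrite /dotr big_ord_recl consr0; congr +%R.
by apply: eq_bigr => i _; rewrite consr_lift mxE.
Qed.

Lemma measurable_dotr n (z : 'rV[R]_n) :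
  measurable_fun setT (fun u : 'rV[R]_n => dotr u z).
Proof.
apply: measurable_sum => i; apply: measurable_funM => //.
exact: (measurable_rV_coord i).
Qed.

Lemma measurable_tensor n : measurable_fun setT (@tensor n).
Proof.
apply: measurable_prod => i _; apply: (measurableT_comp (f := g)).
  by apply/measurable_EFinP; exact: measurable_int g_int.
exact: (measurable_rV_coord i).
Qed.

Lemma integrable_tensor n :
  (lebesgue_rV n).-integrable setT (EFin \o @tensor n).
Proof.
elim: n => [|n IH].
  have -> : @tensor 0 = cst 1 by apply/funext => u; rewrite /tensor big_ord0.
  exact: (@finite_measure_integrable_cst _ _ _ (dirac (0 : 'rV[R]_0))).
apply: (integrable_pushforward (@measurable_consr R n)) => //.
  by apply/measurable_EFinP; exact: measurable_tensor.
rewrite preimage_setT.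
have := integrable_prod g_int IH; apply: eq_integrable => // p _ /=.
by rewrite tensor_consr.
Qed.

Lemma integrable_tensor_cos n (z : 'rV[R]_n) th :
  (lebesgue_rV n).-integrable setT
    (EFin \o (fun u => tensor u * cos (dotr u z + th))).
Proof.
apply: (le_integrable _ _ _ (integrable_tensor n)) => //.
  apply/measurable_EFinP; apply: measurable_funM; first exact: measurable_tensor.
  apply: measurableT_comp; first exact: measurable_cos.
  by apply: measurable_funD => //; exact: measurable_dotr.
by move=> u _ /=; rewrite lee_fin normrM ler_piMr// cos_max.
Qed.

(** One coordinate whose transform vanishes for every phase kills the whole integral: by Fubini the
    other coordinates only shift the phase. *)
Lemma integral_tensor_cos0 n (z : 'rV[R]_n) (i : 'I_n) :
  (forall th, osc g (z ord0 i) th = 0) ->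
  forall th, (\int[lebesgue_rV n]_u (tensor u * cos (dotr u z + th))%:E = 0)%E.
Proof.
elim: n => [|n IH] in z i *; first by case: i.
move=> gi th.
pose f (p : measurableTypeR R * 'rV[R]_n) :=
   g p.1 * tensor p.2 * cos (p.1 * z ord0 ord0 + dotr p.2 (rV_behead z) + th).
have fE : (EFin \o (fun u => tensor u * cos (dotr u z + th))) \o @consr R n = EFin \o f.
  by apply/funext => p; rewrite /f /= tensor_consr dotr_consr.
have fi : (mu \x lebesgue_rV n)%E.-integrable setT (EFin \o f).
  apply: (le_integrable _ _ _ (integrable_prod g_int (integrable_tensor n))) => //.
    rewrite -fE; apply: (@measurableT_comp _ _ _ _ _ _ _ _ (@consr R n)).
      exact: measurable_int (integrable_tensor_cos z th).
    exact: measurable_consr.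
  by move=> p _ /=; rewrite lee_fin normrM ler_piMr// cos_max.
transitivity (\int[mu \x lebesgue_rV n]_p (EFin \o f) p)%E.
  rewrite (integral_pushforward (@measurable_consr R n)) ?preimage_setT ?fE//.
  exact: measurable_int (integrable_tensor_cos z th).
(* The inner integral runs over the factor that contains coordinate [i]: the tail, by induction, or
   the first coordinate, by hypothesis. *)
case: (unliftP ord0 i) => [j|] iE; rewrite {}iE in gi.
  rewrite -(integral12_prod_meas1 fi); apply: integral0_eq => x _.
  have gi' th' : osc g ((rV_behead z) ord0 j) th' = 0 by rewrite mxE.
  rewrite /fubini_F /=.
  rewrite (eq_integral (fun y => ((g x)%:E * (tensor y *
      cos (dotr y (rV_behead z) + (x * z ord0 ord0 + th)))%:E)%E)); last first.
    by move=> y _; rewrite -EFinM /f /= -mulrA; congr (_ * (_ * cos _))%:E; ring.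
  rewrite integralZl//; last exact: integrable_tensor_cos.
  by rewrite (IH _ _ gi') mule0.
rewrite -(integral21_prod_meas1 fi); apply: integral0_eq => y _.
transitivity (\int[mu]_x ((tensor y)%:E *
    (g x * cos (x * z ord0 ord0 + (dotr y (rV_behead z) + th)))%R%:E))%E.
  by apply: eq_integral => x _; rewrite -EFinM /f /= addrA; congr EFin; ring.
rewrite integralZl//; last exact: osc_integrable.
by rewrite -EFin_osc// gi mule0.
Qed.

End tensor_product.

(** * Spectral densities *)

Section spectral.
Context {R : realType} {d : nat}.
Local Notation Lam := (@lebesgue_rV R d).
Implicit Types (u x y z : 'rV[R]_d) (W : 'rV[R]_d -> R).

Lemma dotrBr u x y : dotr u (x - y) = dotr u x - dotr u y.
Proof. by rewrite /dotr -sumrB; apply: eq_bigr => i _; rewrite !mxE mulrBr. Qed.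

(** The real part of the Fourier integral, without the factor [(2 * pi) ^- d]. *)
Definition spectral_kernel W x y : R :=
  \int[Lam]_u (cos (dotr u (x - y)) * W u).

Lemma spectral_kernelC W x y : spectral_kernel W x y = spectral_kernel W y x.
Proof.
by apply: eq_Rintegral => u _; rewrite !dotrBr -cosN opprB.
Qed.

Lemma integrable_spectral W z : Lam.-integrable setT (EFin \o W) ->
  Lam.-integrable setT (EFin \o (fun u => cos (dotr u z) * W u)).
Proof.
move=> Wi; apply: (le_integrable _ _ _ Wi) => //.
  apply/measurable_EFinP; apply: measurable_funM.
    apply: measurableT_comp; [exact: measurable_cos|exact: measurable_dotr].
  by apply/measurable_EFinP; exact: measurable_int Wi.
by move=> u _ /=; rewrite lee_fin normrM ler_piMl// cos_max.
Qed.

(** The squared modulus of the trigonometric sum with coefficients [b] and frequencies [p]. *)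
Definition char_sqr n (b : 'I_n -> R) (p : 'I_n -> 'rV[R]_d) u : R :=
  (\sum_(i < n) b i * cos (dotr u (p i))) ^+ 2 +
  (\sum_(i < n) b i * sin (dotr u (p i))) ^+ 2.

Lemma char_sqr_ge0 n b p u : 0 <= @char_sqr n b p u.
Proof. by rewrite addr_ge0 ?sqr_ge0. Qed.

Lemma char_sqrE n b p u : @char_sqr n b p u =
  \sum_(i < n) \sum_(j < n) b i * b j * cos (dotr u (p i - p j)).
Proof.
rewrite /char_sqr !expr2 !mulr_suml -big_split; apply: eq_bigr => i _ /=.
rewrite !mulr_sumr -big_split; apply: eq_bigr => j _ /=.
by rewrite dotrBr cosB; ring.
Qed.

Lemma Rintegral_lincomb n (b : 'I_n -> R) (f : 'I_n -> 'rV[R]_d -> R) :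
  (forall i, Lam.-integrable setT (EFin \o f i)) ->
  Lam.-integrable setT (EFin \o (fun u => \sum_(i < n) b i * f i u)) /\
  \int[Lam]_u (\sum_(i < n) b i * f i u) = \sum_(i < n) b i * \int[Lam]_u f i u.
Proof.
elim: n => [|n IH] in b f * => fi.
  rewrite big_ord0; under [X in Rintegral _ _ X]eq_fun do rewrite big_ord0.
  rewrite Rintegral_cst// mul0r; split=> //.
  apply: (eq_integrable _ (cst 0%E)) => //; last exact: integrable0.
  by move=> u _ /=; rewrite big_ord0.
have [IHi IHE] := IH (fun i => b (lift ord0 i)) _ (fun i => fi (lift ord0 i)).
have f0i : Lam.-integrable setT (EFin \o (fun u => b ord0 * f ord0 u)).
  by have := integrableZl measurableT (b ord0) (fi ord0).
split.
  have := integrableD measurableT f0i IHi; apply: eq_integrable => // u _ /=.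
  by rewrite big_ord_recl.
under eq_Rintegral do rewrite big_ord_recl.
by rewrite RintegralD// RintegralZl// IHE big_ord_recl.
Qed.

(** The easy half of Bochner's theorem. Since [char_sqr] is nonnegative, it yields both positivity
    and monotonicity in the density. *)
Lemma quad_spectral n (b : 'I_n -> R) p W : Lam.-integrable setT (EFin \o W) ->
  Lam.-integrable setT (EFin \o (fun u => char_sqr b p u * W u)) /\
  quad (spectral_kernel W) b p = \int[Lam]_u (char_sqr b p u * W u).
Proof.
move=> Wi.
pose f i u := \sum_(j < n) b i * b j * (cos (dotr u (p i - p j)) * W u).
have fi i : Lam.-integrable setT (EFin \o f i) /\
    \int[Lam]_u f i u = \sum_(j < n) b i * b j * spectral_kernel W (p i) (p j).
  by apply: Rintegral_lincomb => j; exact: integrable_spectral.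
have [Fi FE] := Rintegral_lincomb (fun=> 1) (fun i => (fi i).1).
have E u : \sum_(i < n) 1 * f i u = char_sqr b p u * W u.
  rewrite char_sqrE mulr_suml; apply: eq_bigr => i _; rewrite mul1r mulr_suml.
  by apply: eq_bigr => j _; rewrite mulrA.
have EE : (fun u => \sum_(i < n) 1 * f i u) = (fun u => char_sqr b p u * W u).
  exact/funext.
rewrite EE in Fi FE; split=> //; rewrite FE /quad.
by apply: eq_bigr => i _; rewrite mul1r (fi i).2.
Qed.

Lemma spectral_kernel_psd W : Lam.-integrable setT (EFin \o W) ->
  (forall u, 0 <= W u) -> psd (spectral_kernel W).
Proof.
move=> Wi W0 n b p; rewrite (quad_spectral b p Wi).2.
by apply: Rintegral_ge0 => u _; rewrite mulr_ge0// char_sqr_ge0.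
Qed.

Lemma le_quad_spectral c n (b : 'I_n -> R) p W V :
  Lam.-integrable setT (EFin \o W) -> Lam.-integrable setT (EFin \o V) ->
  (forall u, 0 <= W u) -> (forall u, 0 <= V u) -> 0 <= c ->
  {ae Lam, forall u, c * W u <= V u} ->
  c * quad (spectral_kernel W) b p <= quad (spectral_kernel V) b p.
Proof.
move=> Wi Vi W0 V0 c0 WV.
have [HWi ->] := quad_spectral b p Wi.
have [HVi ->] := quad_spectral b p Vi.
rewrite -RintegralZl//.
have cHWi : Lam.-integrable setT (EFin \o (fun u => c * (char_sqr b p u * W u))).
  by have := integrableZl measurableT c HWi.
rewrite -lee_fin !fineK; try exact: integrable_fin_num.
apply: ae_ge0_le_integral => //.
- by move=> u _; rewrite lee_fin !mulr_ge0// char_sqr_ge0.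
- exact: measurable_int cHWi.
- by move=> u _; rewrite lee_fin mulr_ge0// char_sqr_ge0.
- exact: measurable_int HVi.
apply: filterS WV => u cWV _.
by rewrite lee_fin mulrCA ler_wpM2l// char_sqr_ge0.
Qed.

End spectral.

(** The left-hand side consists of some of the nonnegative terms of the expanded product. It
    compares the Euclidean norm with a product over coordinates. *)
Lemma sum_sqr_prod {R : realType} n (v : 'I_n -> R) :
  1 + \sum_(i < n) v i * v i <= \prod_(i < n) oneDsqr (v i).
Proof.
elim: n v => [|n IH] v; first by rewrite !big_ord0 addr0.
rewrite !big_ord_recl; have := IH (fun i => v (lift ord0 i)).
set A := \sum_(i < n) _; set B := \prod_(i < n) _ => AB.
have A0 : 0 <= A by apply: sumr_ge0 => i _; rewrite -expr2 sqr_ge0.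
rewrite /oneDsqr -expr2; set w := v ord0 ^+ 2.
have w0 : 0 <= w by exact: sqr_ge0.
have := mulr_ge0 w0 A0; have := ler_wpM2l w0 AB.
by rewrite mulrDr mulr1 mulrDl mul1r; lra.
Qed.

(** * Decay and positivity of the comparison density *)

Section spectral_lower_bound.
Context {R : realType} {d : nat}.
Local Notation Lam := (@lebesgue_rV R d).
Implicit Types (u x y z : 'rV[R]_d).

(** Apply [sinc_sqr_le] in each coordinate. The factor 2 comes from bounding both [1] and
    [enorm u ^+ r] by [Q ^+ r]. *)
Lemma tensor_sinc_decay (a : R) r u : 0 < a -> (0 < r)%N ->
  tensor (fun v => sinc a v ^+ (2 * r)) u * (1 + enorm u ^+ r) <=
  2 * ((1 + (a ^+ 2)^-1) ^+ r) ^+ d.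
Proof.
move=> a0 r0; set K := 1 + (a ^+ 2)^-1.
have K0 : 0 <= K by rewrite addr_ge0 ?invr_ge0 ?sqr_ge0.
have g0 v : 0 <= sinc a v ^+ (2 * r) by rewrite exprM exprn_ge0 ?sqr_ge0.
have o0 v : 0 <= oneDsqr (v : R) by exact: le_trans ler01 (oneDsqr_ge1 v).
pose Q := \prod_(i < d) oneDsqr (u ord0 i).
have QT : tensor (fun v => sinc a v ^+ (2 * r)) u * Q ^+ r <= (K ^+ r) ^+ d.
  rewrite /tensor /Q -prodrXl -big_split /= -[X in _ ^+ X]card_ord -prodr_const.
  apply: ler_prod => i _; rewrite mulr_ge0 ?g0 ?(exprn_ge0 _ (o0 _))//=.
  have so0 : 0 <= sinc a (u ord0 i) ^+ 2 * oneDsqr (u ord0 i).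
    exact: mulr_ge0 (sqr_ge0 _) (o0 _).
  rewrite exprM -exprMn; apply: lerXn2r => //.
  have o_gt0 : 0 < oneDsqr (u ord0 i) by exact: lt_le_trans ltr01 (oneDsqr_ge1 _).
  by have := sinc_sqr_le (u ord0 i) a0; rewrite ler_pdivlMr.
have uQ : 1 + enorm u ^+ 2 <= Q.
  by rewrite sqr_enorm /dotr; exact: sum_sqr_prod.
have Q1 : 1 <= Q by apply: le_trans uQ; rewrite lerDl sqr_ge0.
have Qr1 : 1 <= Q ^+ r by rewrite exprn_ege1.
have urQ : enorm u ^+ r <= Q ^+ r.
  rewrite lerXn2r ?nnegrE ?sqrtr_ge0 ?(le_trans ler01)//.
  apply: le_trans uQ; have := sqr_ge0 (enorm u - 1); have := sqr_ge0 (enorm u).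
  rewrite sqrrB expr1n mulr1; lra.
apply: le_trans (_ : tensor (fun v => sinc a v ^+ (2 * r)) u * (2 * Q ^+ r) <= _).
  rewrite ler_wpM2l//; last by rewrite mulrDl !mul1r lerD.
  by apply: prodr_ge0 => i _.
by rewrite mulrCA ler_wpM2l.
Qed.

(** A zero integral would make the nonnegative integrand vanish almost everywhere. *)
Lemma tensor_sinc_gt0 (a : R) r : 0 < a -> (0 < r)%N ->
  0 < \int[Lam]_u tensor (fun v => sinc a v ^+ (2 * r)) u.
Proof.
move=> a0 r0; pose g v := sinc a v ^+ (2 * r); rewrite -/g.
have gi : lebesgue_measure.-integrable setT (EFin \o g) by exact: integrable_sinc_pow.
have Ti := integrable_tensor gi d.
have g0 v : 0 <= g v by rewrite /g exprM exprn_ge0 ?sqr_ge0.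
have T0 u : 0 <= tensor g u by apply: prodr_ge0.
rewrite lt_neqAle Rintegral_ge0 ?andbT//; apply/negP => /eqP int0.
have ae0 : ae_eq Lam setT (EFin \o @tensor _ g d) (cst 0%E).
  apply/(ae_eq_integral_abs Lam) => //; first exact: measurable_int Ti.
  rewrite -[RHS]/(0%:E) int0 fineK; last exact: integrable_fin_num.
  by apply: eq_integral => u _; rewrite gee0_abs// lee_fin.
(* On this box [0 < a * u_i < 1 < pi], so every factor is positive, and its volume [a^-1 ^+ d] is
   not zero. *)
pose B := [set u : 'rV[R]_d | forall i, `]0, a^-1[%classic (u ord0 i)].
have mB : measurable B.
  by apply: (@measurable_rV_box _ (measurableTypeR R) d (fun=> `]0, a^-1[%classic)).
have BE : (Lam B = \prod_(i < d) (a^-1)%:E)%E.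
  rewrite (lebesgue_rV_box (A := fun=> `]0, a^-1[%classic))//.
  apply: eq_bigr => i _; rewrite lebesgue_measure_itv/= lte_fin invr_gt0 a0.
  by rewrite -EFinB subr0.
have B0 : Lam B = 0%E.
  apply/negligibleP => //; apply: negligibleS ae0 => u Bu /= /(_ I) Tu0.
  have := EFin_inj Tu0.
  apply/eqP; apply/prodf_neq0 => i _.
  have := Bu i; rewrite /= in_itv /= => /andP[u0 u1].
  rewrite /g expf_neq0// /sinc (gt_eqF u0) gt_eqF// divr_gt0 ?mulr_gt0//.
  apply: sin_gt0_pi; rewrite mulr_gt0//=.
  rewrite (@lt_trans _ _ 1)//; first by rewrite mulrC -ltr_pdivlMr// div1r.
  by have := @pi_ge2 R; lra.
move: B0; rewrite BE prodEFin => B0; have := EFin_inj B0; apply/eqP.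
by rewrite prodr_const expf_eq0 invr_eq0 gt_eqF// andbF.
Qed.

End spectral_lower_bound.

(** * The NEB property from the spectral lower bound *)

Section spectral_NEB.
Context {R : realType} {disp : measure_display} {Omega : measurableType disp}.
Context {P : probability Omega R} {d : nat} (xi : 'rV[R]_d -> {RV P >-> R}).
Hypotheses (xi_L2 : second_order xi) (xi_mean : zero_mean xi).
Local Notation k := (cov_fun xi).
Local Notation Lam := (@lebesgue_rV R d).

Lemma cov_fun_spectral S : spectral_density xi S ->
  forall x y, k x y = (2 * pi) ^- d * spectral_kernel S x y.
Proof.
move=> [_ _ SE] x y; have := congr1 (@complex.Re R) (SE x y).
rewrite /= mul0r subr0 => ->; congr (_ * _); apply: eq_Rintegral => u _ /=.
by rewrite mulr0 subr0.
Qed.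

(** The bound [e] is uniform in the number of points, their positions and the coefficients. Distance
    is measured in one coordinate because the comparison kernel is supported in a cube. *)
Lemma pred_error_lower_bound S (C : R) r (eps : R) : spectral_density xi S ->
  0 < C -> (0 < r)%N -> 0 < eps ->
  {ae Lam, forall u, C <= S u * (1 + enorm u ^+ r)} ->
  exists2 e, 0 < e & forall n (c : 'I_n -> R) (p : 'I_n -> 'rV[R]_d)
      (x : 'rV[R]_d),
    (forall i, exists j, eps <= `|x ord0 j - p i ord0 j|) ->
    e <= pred_error k c p x.
Proof.
move=> HS C0 r0 eps0 SC; have [S0 Si _] := HS.
(* The half-side [2 * r * a] of the supporting cube is then [eps / 2], strictly below [eps]. *)
pose a := eps / (4 * r%:R).
have r0R : 0 < r%:R :> R by rewrite ltr0n.
have a0 : 0 < a by rewrite divr_gt0// mulr_gt0.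
pose g (v : R) := sinc a v ^+ (2 * r).
have g0 v : 0 <= g v by rewrite /g exprM exprn_ge0 ?sqr_ge0.
have gi : (@lebesgue_measure R).-integrable setT (EFin \o g).
  exact: integrable_sinc_pow.
pose T : 'rV[R]_d -> R := @tensor R g d.
have T0 u : 0 <= T u by apply: prodr_ge0.
have Ti : Lam.-integrable setT (EFin \o T) by exact: integrable_tensor.
have IT0 : 0 < \int[Lam]_u T u by exact: tensor_sinc_gt0.
pose M := 2 * ((1 + (a ^+ 2)^-1) ^+ r) ^+ d : R.
have M0 : 0 < M.
  by rewrite mulr_gt0// !exprn_gt0// ltr_pwDl// invr_ge0 sqr_ge0.
have TS : {ae Lam, forall u, (C / M) * T u <= S u}.
  apply: filterS SC => u CS.
  have w0 : 0 < 1 + enorm u ^+ r by rewrite ltr_pwDl// exprn_ge0// sqrtr_ge0.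
  rewrite -(ler_pM2r w0); apply: le_trans CS.
  have -> : C / M * T u * (1 + enorm u ^+ r) =
    C * (T u * (1 + enorm u ^+ r)) / M by ring.
  rewrite ler_pdivrMr// ler_wpM2l ?(ltW C0)//.
  exact: tensor_sinc_decay.
have pi0 : 0 < (2 * pi) ^- d :> R by rewrite invr_gt0 exprn_gt0// mulr_gt0// pi_gt0.
exists ((2 * pi) ^- d * (C / M * \int[Lam]_u T u)).
  by rewrite !mulr_gt0// invr_gt0.
move=> n c p x far.
have -> : pred_error k c p x = (2 * pi) ^- d * pred_error (spectral_kernel S) c p x.
  rewrite /pred_error /quad mulr_sumr; apply: eq_bigr => i _.
  rewrite mulr_sumr; apply: eq_bigr => j _.
  by rewrite (cov_fun_spectral HS) mulrCA.
rewrite ler_pM2l//.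
apply: le_trans (_ : C / M * pred_error (spectral_kernel T) c p x <= _); last first.
  by apply: le_quad_spectral => //; rewrite ltW// divr_gt0.
rewrite ler_wpM2l ?(ltW (divr_gt0 C0 M0))//.
rewrite pred_errorE; last exact: spectral_kernelC.
have kT0 i : spectral_kernel T x (p i) = 0.
  have [j xj] := far i.
  rewrite /spectral_kernel /Rintegral -[RHS]/(fine 0%:E); congr fine.
  rewrite -[RHS](@integral_tensor_cos0 R g gi d (x - p i) j _ 0).
    by apply: eq_integral => u _; rewrite addr0 mulrC.
  move=> th; apply: osc_sinc_pow => //; rewrite !mxE.
  apply: lt_le_trans xj; rewrite natrM /a.
  have -> : 2 * r%:R * (eps / (4 * r%:R)) = eps / 2 by field; rewrite gt_eqF.
  lra.
have -> : spectral_kernel T x x = \int[Lam]_u T u.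
  apply: eq_Rintegral => u _; rewrite subrr /dotr big1 ?cos0 ?mul1r// => i _.
  by rewrite mxE mulr0.
rewrite big1 ?mulr0 ?subr0; last by move=> i _; rewrite kT0 mulr0.
by rewrite lerDl; exact: spectral_kernel_psd.
Qed.

Lemma spectral_NEB S C r : continuous_cov xi -> spectral_density xi S ->
  0 < C -> (0 < r)%N ->
  {ae Lam, forall u, C <= S u * (1 + enorm u ^+ r)} -> NEB xi.
Proof.
move=> xi_cont HS C0 r0 SC s x; split.
  exact: kriging_variance_adherent.
move=> /(kriging_variance_cvg0P xi_L2 xi_mean) kv0.
move=> B /nbhs_ballP[eps /= eps0 sB]; apply: contrapT => sx.
(* Balls of ['rV[R]_d] are cubes, so a point outside the ball of radius [eps] is off by at least
   [eps] in some coordinate. *)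
have far n : exists j, eps <= `|x ord0 j - s n ord0 j|.
  apply: contrapT => near_n; apply: sx; exists (s n); split; first by exists n.
  apply: sB; split=> // i j; rewrite ord1 /ball /= ltNge; apply/negP => le_eps.
  by apply: near_n; exists j.
have [e e0 le_e] := pred_error_lower_bound HS C0 r0 eps0 SC.
have [N _ /(_ N (leqnn N))[c]] := kv0 _ e0.
by rewrite ltNge le_e.
Qed.

End spectral_NEB.

Theorem proposition1 (R : realType) (disp : measure_display)
    (Omega : measurableType disp) (P : probability Omega R)
    (d : nat) (d_gt0 : (0 < d)%N) (xi : 'rV[R]_d -> {RV P >-> R})
    (xi_L2 : second_order xi) (xi_mean : zero_mean xi)
    (xi_cont : continuous_cov xi) :
  (stationary_cov xi ->
   (exists S : 'rV[R]_d -> R, spectral_density xi S /\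
     exists (C : R) (r : nat), [/\ 0 < C, (1 <= r)%N &
       {ae lebesgue_rV d, forall u, C <= S u * (1 + enorm u ^+ r)}]) ->
   NEB xi) /\
  ((exists s alpha : R, [/\ 0 < s, 0 < alpha &
     forall x y, cov_fun xi x y =
       s ^+ 2 * expR (- alpha * enorm (x - y) ^+ 2)]) ->
   ~ NEB xi).
Proof.
split=> [_ [S [HS [C [r [C0 r0 SC]]]]]|[s [alpha [s0 alpha0 kE]]]].
  exact: spectral_NEB HS C0 r0 SC.
exact: gaussian_not_NEB s0 alpha0 kE.
Qed.
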